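(* Let $A$ be a metric space endowed with a Borel probability measure $\mu$ and a doubling Borel measure $\mu_*$ (possibly the same measure as $\mu$, possibly not), and suppose $A$ satisfies conditions (O), (B), (T), (G) listed in the context. Let $X_1,X_2,\ldots$ be independent $\mu$-distributed random elements of $A$. Let $\beta\in[0,\infty]$ and let $k:\mathbb{N}\to\mathbb{N}$ satisfy $\lim_{n\to\infty}k(n)/\log n=\beta$ and $\lim_{n\to\infty}k(n)/n=0$. Let $\ell\in\mathbb{N}$ and $d>0$, and for each $j\in[\ell]$ let $a_j>0$, $b_j\ge0$. Suppose that for each $K\in\mathbb{N}$ there exists $r_0(K)>0$ such that for all $r\in(0,r_0(K))$ there is a partition $\{T(j,K,r):j\in[\ell]\}$ of $A$ with the following two properties. Firstly, for each fixed $K\in\mathbb{N}$ and $j\in[\ell]$, $$\kappa(T(j,K,r),r)=O(r^{-b_j})\quad\text{as }r\downarrow0;$$ and secondly, for all $K\in\mathbb{N}$, $j\in[\ell]$, $r\in(0,r_0(K))$ and any $G\subset A$ intersecting $T(j,K,r)$ with $\operatorname{diam}(G)\le Kr$, $$\mu(G_r\setminus G)\ge a_jr^d.$$ Then, almost surely, $$\limsup_{n\to\infty}\big(nM_{n,k(n)}^d/k(n)\big)\le\max_{j\in[\ell]}(a_j^{-1})\quad\text{if }\beta=\infty;$$ $$\limsup_{n\to\infty}\big(nM_{n,k(n)}^d/\log n\big)\le\max_{j\in[\ell]}\big(a_j^{-1}\hat H_\beta(b_j/d)\big)\quad\text{if }\beta<\infty.$$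
   Context: $\mathbb{N}=\{1,2,\ldots\}$, $[\ell]=\{1,\ldots,\ell\}$. $B(x,r)=\{y\in A:\operatorname{dist}(x,y)\le r\}$. For $D\subset A$ and $r>0$: $D_r=\{y\in A:\operatorname{dist}(y,D)\le r\}$; $\kappa(D,r)$ is the minimal $m\in\mathbb{N}$ such that $D$ can be covered by $m$ balls of radius $r$ centred in $D$; $\operatorname{diam}(D)=\sup_{u,v\in D}\operatorname{dist}(u,v)$ for non-empty $D$. $\mu_*$ is a doubling measure: there is a constant $c_*$ (a doubling constant for $\mu_*$) with $\mu_*(B(x,2r))\le c_*\mu_*(B(x,r))$ for all $x\in A$ and $r>0$. Conditions on $A$: (O) There is a total ordering of the elements of $A$. (B) For all $x\in A$ and $r>0$, the ball $B(x,r)$ is connected. (T) $A$ is unicoherent and connected (unicoherent: whenever $A=E\cup F$ with $E,F$ closed and connected, $E\cap F$ is connected). (G) There exist $\delta_1>0$ and $K_0\in(1,\infty)$ such that for all $r<\delta_1$ and any $x\in A$, the number of components of $A\setminus B(x,r)$ is at most two, and if there are two components, at least one of them has diameter at most $K_0r$. $\mathcal{X}_n=\{X_1,\ldots,X_n\}$. $G(\mathcal{X}_n,r)$ is the graph with vertex set $\mathcal{X}_n$ and an edge between each pair of vertices at distance at most $r$. A graph of order $n$ is $k$-connected ($k<n$) if it cannot be disconnected by the removal of at most $k-1$ vertices. $M_{n,k}$ is the minimal $r$ such that $G(\mathcal{X}_n,r)$ is $k$-connected. $H(t)=1-t+t\log t$ for $t>0$ and $H(0)=1$. For $a\in[0,\infty)$,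 $\hat H_a:[0,\infty)\to[a,\infty)$ is defined by: $y=\hat H_a(x)$ if and only if $yH(a/y)=x$ and $y\ge a$, with $\hat H_0(0)=0$. (Thus $\hat H_0(x)=x$ and $\hat H_a(0)=a$.) *)

(* Defs.v *)
From HB Require Import structures.
From mathcomp Require Import all_boot all_order all_algebra.
From mathcomp Require Import all_classical all_reals all_analysis.

Set Implicit Arguments.
Unset Strict Implicit.
Unset Printing Implicit Defensive.

Import Order.TTheory GRing.Theory Num.Theory.
Import numFieldNormedType.Exports.

Local Open Scope classical_set_scope.
Local Open Scope card_scope.
Local Open Scope ring_scope.

(* A metric space together with a sigma-algebra, a priori unrelated to the
   metric.  A measurableType is pointed; this is harmless for a space that
   carries a probability measure. *)
#[short(type="measurableMetricType")]
HB.structure Definition MeasurableMetric (d : measure_display)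
    (R : realType) :=
  { T of Metric R T & Measurable d T }.

Definition borel_sigma_algebra (d : measure_display) (R : realType)
    (A : measurableMetricType d R) : Prop :=
  @measurable d A = <<s [set U : set A | open U] >>.

Section MetricNotions.
Context {R : realType} {A : metricType R}.
Implicit Types (x y : A) (D : set A) (r : R).

(* The library's [closed_ball] is the closure of the open ball, which may be
   smaller than this set. *)
Definition cball x r : set A := [set y | mdist x y <= r].

Definition setdist y D : \bar R := ereal_inf [set (mdist y z)%:E | z in D].

Definition dilate D r : set A := [set y | (setdist y D <= r%:E)%E].

(* [-oo] on the empty set, where the diameter is left undefined. *)
Definition diam D : \bar R :=
  ereal_sup [set (mdist uv.1 uv.2)%:E | uv in D `*` D].

(* [+oo] if no finite number of balls suffices. *)
Definition covering_number D r : \bar R :=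
  ereal_inf [set (m%:R)%:E | m in [set m : nat | (0 < m)%N /\
    exists c : 'I_m -> A,
      (forall i, D (c i)) /\ D `<=` \bigcup_i cball (c i) r]].

Definition components D : set (set A) :=
  [set C | exists2 y, D y & C = connected_component D y].

End MetricNotions.

(* Finiteness and positivity on balls are part of the usual definition of a
   doubling measure; without them the null measure would be doubling. *)
Definition doubling_measure (d : measure_display) (R : realType)
    (A : measurableMetricType d R) (nu : {measure set A -> \bar R}) : Prop :=
  (forall (x : A) (r : R), 0 < r -> (0 < nu (cball x r) < +oo)%E) /\
  exists c : R, forall (x : A) (r : R), 0 < r ->
    (nu (cball x (2 * r)) <= c%:E * nu (cball x r))%E.

Definition condition_O (R : realType) (A : metricType R) : Prop :=
  exists le : rel A,
    [/\ reflexive le, antisymmetric le, transitive le & total le].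

Definition condition_B (R : realType) (A : metricType R) : Prop :=
  forall (x : A) (r : R), 0 < r -> connected (cball x r).

Definition unicoherent (A : topologicalType) : Prop :=
  forall E F : set A, closed E -> connected E -> closed F -> connected F ->
    E `|` F = [set: A] -> connected (E `&` F).

Definition condition_T (R : realType) (A : metricType R) : Prop :=
  unicoherent A /\ connected [set: A].

Definition condition_G (R : realType) (A : metricType R) : Prop :=
  exists delta1 K0 : R, [/\ 0 < delta1, 1 < K0 &
    forall (r : R) (x : A), 0 < r -> r < delta1 ->
      (components (~` cball x r) #<= `I_2) /\
      (components (~` cball x r) #= `I_2 ->
        exists2 C, components (~` cball x r) C & (diam C <= (K0 * r)%:E)%E)].

Definition mutually_independent (d d' : measure_display) (R : realType)
    (Om : measurableType d) (A : measurableType d') (P : probability Om R)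
    (X : nat -> {mfun Om >-> A}) : Prop :=
  forall (s : seq nat) (E : nat -> set A), uniq s ->
    (forall i, measurable (E i)) ->
    P (\bigcap_(i in [set` s]) (X i @^-1` E i)) =
    (\prod_(i <- s) P (X i @^-1` E i))%E.

Definition k_connected (V : finType) (e : rel V) (k : nat) : Prop :=
  (k < #|V|)%N /\
  forall S : {set V}, (#|S| <= k.-1)%N ->
    forall x y : V, x \notin S -> y \notin S ->
      connect [rel u v | [&& u \notin S, v \notin S & e u v]] x y.

(* The vertices are the indices, so the graph always has order [n], also when
   sample points coincide. *)
Definition geometric_graph (R : realType) (A : metricType R) (n : nat)
    (x : nat -> A) (r : R) : rel 'I_n :=
  [rel i j : 'I_n | (i != j) && (mdist (x i) (x j) <= r)].

(* [+oo] if the graph is not k-connected for any r, that is, if [n <= k]. *)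
Definition connectivity_threshold (R : realType) (A : metricType R)
    (x : nat -> A) (n k : nat) : \bar R :=
  ereal_inf [set r%:E | r in
    [set r : R | 0 <= r /\ k_connected (@geometric_graph R A n x r) k]].

Definition Hfun (R : realType) (t : R) : R :=
  if t == 0 then 1 else 1 - t + t * ln t.

(* For [0 <= a] and [0 <= x] exactly one [y] qualifies.  As [a / 0 = 0], the
   convention that the value is 0 at [a = x = 0] is included. *)
Definition Hhat (R : realType) (a x : R) : R :=
  xget 0 [set y : R | y * Hfun (a / y) = x /\ a <= y].

(* Main.v *)
Require Import Defs.
From HB Require Import structures.
From mathcomp Require Import all_boot all_order all_algebra.
From mathcomp Require Import all_classical all_reals all_analysis.
From mathcomp Require Import finmap ring lra.

Set Implicit Arguments.
Unset Strict Implicit.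
Unset Printing Implicit Defensive.

Import Order.TTheory GRing.Theory Num.Theory.
Import numFieldNormedType.Exports.

Local Open Scope classical_set_scope.
Local Open Scope ring_scope.

(** If the graph of radius [r] on the first [n] points is not [k]-connected, then the
removal of a set [S] of fewer than [k] points leaves two clusters [U] and [W], each at
distance above [r] from all the other points outside [S]
([clusters_of_not_k_connected]).  Either way this forces a region of definite mass to
contain sample points from [S] only.

If [U] has diameter at most [L * r], the region is the annulus of width almost [r]
around it.  After rounding [U] to a net of mesh [dl * r], the annulus becomes one of a
finite family ([small_cluster_annulus]); if it starts from a set that meets the part
[T j], its mass is at least about [a j * r `^ d], and the covering and doubling
hypotheses leave [O(r `^ (- b j))] such annuli.

If [U] and [W] both have diameter above [L * r], the region is a union of [m] disjoint
balls ([large_clusters_vacant_family]).  Call a point vacant when it is at distance at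
least [r / 2] from all points outside [S].  The vacant set separates [U] from [W], as
the open neighbourhoods of radius [r / 2] of [U] and of the other points outside [S] are
disjoint.  If vacant
points occur near every point of [U], or of [W], then following the cluster gives [m]
vacant points far from each other.  Otherwise some [u] in [U] and [w] in [W] are centres
of large balls without vacant points.  By unicoherence there is a connected vacant set
that separates [u] from [w] ([separating_boundary]).  It cannot lie in a ball of radius
[m * r]: by [condition_G] one side would then be small, although each side contains one
of the large balls ([boundary_not_small]).  So it meets [m] concentric spheres at
distance [r] from each other.  There are [O(r `^ (- d))] such unions up to rounding, and
the choice of [m] makes their mass as large a multiple of [r `^ d] as desired.

By [bad_sets], [k]-connectivity can thus fail only if one of these sets, whose number is
polynomial in [r^-1], receives fewer than [k] points.  For a
single set of mass [p] the probability of at most [kap] hits among [N] points is at most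
[expR (s * kap - N * p * (1 - expR (- s)))] for each [s >= 0] ([hits_lower_tail]).  With
[n * r `^ d = v * ln n] and [k n = beta * ln n] the contribution of the part [j] is the
power of [n] with exponent [b j / d + s * beta - a j * v * (1 - expR (- s))].  The
supremum over [s] is a Legendre transform: some [s] makes the exponent negative as soon
as [a j * v] exceeds [Hhat beta (b j / d)] ([Hhat_lt]).  A negative exponent suffices for
the Borel-Cantelli lemma along the times [m ^ p], and monotonicity in the sample and the
radius fills the gaps ([ae_threshold_log]).  When [k n] dominates [ln n] the bounds are
summable over all [n] as soon as [a j * v] exceeds [1] for all [j]
([ae_threshold_superlog]). *)

(** * Balls in a metric space *)

Section Balls.
Context {R : realType} {A : metricType R}.
Implicit Types (x y z : A) (r : R) (D U : set A).

Lemma cball_nbhs x r : 0 < r -> nbhs x (cball x r).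
Proof.
move=> r0; apply: (@filterS _ _ _ (ball x r)); last exact: nbhsx_ballx.
by rewrite ballEmdist => y /=; rewrite /cball/=; apply: ltW.
Qed.

Lemma nbhs_cball x U : nbhs x U -> exists2 r, 0 < r & cball x r `<=` U.
Proof.
move/nbhs_ballP => [e/= e0 eU]; exists (e / 2); first by rewrite divr_gt0.
move=> y /=; rewrite /cball/= => ye; apply: eU; rewrite ballEmdist/=.
by rewrite (le_lt_trans ye)// ltr_pdivrMr// ltr_pMr// ltr1n.
Qed.

Lemma open_mball x r : open (ball x r).
Proof.
rewrite openE => y; rewrite ballEmdist/= => xy.
apply/nbhs_ballP; exists (r - mdist x y); rewrite /= ?subr_gt0// => z.
rewrite ballEmdist /= ltrBrDl; exact/le_lt_trans/metric_triangle.
Qed.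

Lemma closureP D x :
  closure D x <-> forall e, 0 < e -> exists2 y, D y & mdist x y < e.
Proof.
split=> [cDx e e0|h U /nbhs_ballP[e/= e0 eU]].
  by have [y [Dy]] := cDx _ (nbhsx_ballx x e e0); rewrite ballEmdist/=; exists y.
by have [y Dy xy] := h _ e0; exists y; split => //; apply: eU; rewrite ballEmdist.
Qed.

Lemma mdist_lipschitz x y z : `|mdist x y - mdist x z| <= mdist y z.
Proof.
rewrite ler_norml; have := metric_triangle x y z; have := metric_triangle x z y.
by rewrite (metric_sym z y) => *; apply/andP; split; lra.
Qed.

Lemma mdist_continuous x : continuous (mdist x : A -> R).
Proof.
move=> y; apply/cvgrPdist_lt => e e0.
apply: filterS (nbhsx_ballx y e e0) => z; rewrite ballEmdist/= => yz.
exact: le_lt_trans (mdist_lipschitz _ _ _) yz.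
Qed.

Lemma closed_cball x r : closed (cball x r).
Proof.
rewrite (_ : cball x r = mdist x @^-1` [set t | t <= r])//.
by apply: closed_comp => [y _|]; [exact: mdist_continuous|exact: closed_le].
Qed.

Lemma setdist_le_mdist x y D : D y -> (setdist x D <= (mdist x y)%:E)%E.
Proof. by move=> Dy; apply: ereal_inf_lbound; exists y. Qed.

Lemma setdist_ltP x D r : (setdist x D < r%:E)%E -> exists2 y, D y & mdist x y < r.
Proof.
move=> /ereal_inf_lt[_ [y Dy <-]]; rewrite lte_fin.
by exists y.
Qed.

(** The slack [e] is there because the infimum in [setdist] need not be attained. *)
Lemma dilateP D r x :
  dilate D r x <-> forall e, 0 < e -> exists2 y, D y & mdist x y < r + e.
Proof.
rewrite /dilate/=; split=> [xr e e0|h].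
  by apply: setdist_ltP; rewrite (le_lt_trans xr)// lte_fin ltrDl.
apply/lee_addgt0Pr => e e0; have [y Dy xy] := h _ e0.
by rewrite (le_trans (setdist_le_mdist x Dy))// lee_fin ltW.
Qed.

Lemma closed_dilate D r : closed (dilate D r).
Proof.
move=> x /closureP cx; apply/dilateP => e e0.
have e20 : 0 < e / 2 by rewrite divr_gt0.
have [y /dilateP/(_ _ e20)[z Dz yz] xy] := cx _ e20.
by exists z => //; rewrite (le_lt_trans (metric_triangle x y z))//; lra.
Qed.

Lemma diam_ub D c : (diam D <= c%:E)%E <->
  forall x y, D x -> D y -> mdist x y <= c.
Proof.
split=> [h x y Dx Dy|h].
  rewrite -lee_fin (le_trans _ h)//; apply: ereal_sup_ubound.
  by exists (x, y).
by apply: ge_ereal_sup => _ [[x y] [/= Dx Dy] <-]; rewrite lee_fin; apply: h.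
Qed.

(** The intermediate value theorem for the distance to a point. *)
Lemma connected_mdist D x y t : connected D -> D x -> D y ->
  0 <= t <= mdist x y -> exists2 z, D z & mdist x z = t.
Proof.
move=> cD Dx Dy tI.
have cI : connected (mdist x @` D).
  apply: connected_continuous_connected => //.
  exact/continuous_subspaceT/mdist_continuous.
have /connected_intervalP/(_ 0 (mdist x y)) := cI.
case/(_ _ _ t tI).
- by exists x => //; rewrite mdistxx.
- by exists y.
- by move=> z Dz zt; exists z.
Qed.

End Balls.

(** * Connected sets in a space whose balls are connected *)

Section Unicoherence.
Context {R : realType} {A : metricType R}.
Implicit Types (x y z : A) (r : R) (D E U : set A).
Hypothesis balls_connected : condition_B A.

Lemma open_connected_component U x : open U -> open (connected_component U x).
Proof.
move=> oU; rewrite openE => y Uxy.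
have /nbhs_cball[r r0 rU] : nbhs y U.
  by apply: open_nbhs_nbhs; split => //; exact: connected_component_sub Uxy.
rewrite /interior; apply: filterS (cball_nbhs _ r0).
rewrite (same_connected_component Uxy); apply: connected_component_max => //.
  by rewrite /cball/= mdistxx ltW.
exact: balls_connected.
Qed.

Lemma closure_component_sub D x : closed D ->
  closure (connected_component (~` D) x) `<=` connected_component (~` D) x `|` D.
Proof.
move=> cD z Ez; have [Dz|nDz] := pselect (D z); [by right|left].
have oE := open_connected_component z (closed_openC cD).
have [|y [Exy Ezy]] := Ez (connected_component (~` D) z).
  by apply: open_nbhs_nbhs; split => //; exact: connected_component_refl.
exact: connected_component_trans Exy (connected_component_sym Ezy).
Qed.

Lemma closure_component_meets D x : connected [set: A] -> closed D -> D !=set0 ->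
  ~ D x -> closure (connected_component (~` D) x) `&` D !=set0.
Proof.
move=> cA cD [y Dy] nDx; apply/set0P/eqP => ED0.
set E := connected_component (~` D) x in ED0 *.
have cE : closed E.
  move=> z Ez; have [//|Dz] := closure_component_sub cD Ez.
  by have : set0 z by rewrite -ED0.
have EA : E = [set: A].
  apply: cA.
  - by exists x; apply: connected_component_refl.
  - by exists E; [exact/open_connected_component/closed_openC|rewrite setTI].
  - by exists E; rewrite ?setTI.
by have : E y by [rewrite EA]; move/connected_component_sub.
Qed.

(** Every other component of [~` D] has [D]-points in its closure, so it hangs
together with [D]. *)
Lemma connected_setC_component D x : connected [set: A] -> closed D ->
  connected D -> D !=set0 -> connected (~` connected_component (~` D) x).
Proof.
move=> cA cD kD [d Dd]; set C := connected_component (~` D) x.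
pose P y := ~ C y.
pose F y := connected_component (~` D) y `|` D.
have -> : ~` C = \bigcup_(y in P) F y.
  apply/seteqP; split=> [y nCy|z [y nCy [Eyz Cz|Dz /connected_component_sub//]]].
    exists y => //; have [Dy|nDy] := pselect (D y); [by right|left].
    exact: connected_component_refl.
  exact/nCy/(connected_component_trans Cz)/connected_component_sym.
apply: bigcup_connected => [|y _].
  by exists d => y _; right.
have [Dy|nDy] := pselect (D y).
  by rewrite /F connected_component_out ?set0U// => /(_ Dy).
have -> : F y = closure (connected_component (~` D) y) `|` D.
  apply/seteqP; split=> z [|Dz]; [|by right| |by right].
    by move/subset_closure; left.
  exact: closure_component_sub.
apply: connectedU => //; first by apply: closure_component_meets => //; exists d.
exact/connected_closure/component_connected.
Qed.

(** The boundary of a component of the complement of a closed connected set is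
the intersection of two closed connected sets that cover the space. *)
Lemma connected_component_boundary D x : condition_T A -> closed D ->
  connected D -> D !=set0 ->
  connected (closure (connected_component (~` D) x) `&`
             ~` connected_component (~` D) x).
Proof.
move=> [uA cA] cD kD D0; apply: uA.
- exact: closed_closure.
- exact/connected_closure/component_connected.
- exact/open_closedC/open_connected_component/closed_openC.
- exact: connected_setC_component.
- apply/seteqP; split => // y _.
  have [/subset_closure|] := pselect (connected_component (~` D) x y); last by right.
  by left.
Qed.

End Unicoherence.

(** * Separation by a small connected set *)

Section TwoElements.
Context {T : choiceType}.
Implicit Types (C : set T) (x y z : T).

Lemma card_le2_mem C x y : (C #<= `I_2)%card -> C x -> C y -> x != y ->
  forall z, C z -> z = x \/ z = y.
Proof.
move=> C2 Cx Cy xy z Cz; have [->|zx] := eqVneq z x; first by left.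
have [->|zy] := eqVneq z y; first by right.
have : ([set` (x |` [fset y; z])%fset] #<= `I_2)%card.
  apply: card_le_trans C2; apply: subset_card_le => t /=.
  by rewrite !inE => /or3P[] /eqP ->.
have /card_eq_fsetP h : #|` (x |` [fset y; z])%fset| = 3%N.
  by rewrite cardfsU1 cardfs2 !inE negb_or xy/= ![_ == z]eq_sym zx zy.
by rewrite (card_le_eql h) card_le_II.
Qed.

Lemma card_eq2 C x y : (C #<= `I_2)%card -> C x -> C y -> x != y ->
  (C #= `I_2)%card.
Proof.
move=> C2 Cx Cy xy; have -> : C = [set` [fset x; y]%fset].
  apply/seteqP; split=> z /=; rewrite !inE.
    by case/(card_le2_mem C2 Cx Cy xy) => ->; rewrite eqxx ?orbT.
  by case/orP => /eqP ->.
by apply/card_eq_fsetP; rewrite cardfs2 xy.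
Qed.

End TwoElements.

Section Separation.
Context {R : realType} {A : metricType R}.
Implicit Types (x y z u w : A) (r s t : R) (B C D E P Q N : set A).

Definition three_far P t := exists p : 'I_3 -> A,
  (forall i, P (p i)) /\ forall i j, i != j -> t < mdist (p i) (p j).

(** By the pigeonhole principle, two of the three points share one of the two sets. *)
Lemma three_far_cover P D E t : three_far P t -> P `<=` D `|` E ->
  (forall x y, D x -> D y -> mdist x y <= t) ->
  (forall x y, E x -> E y -> mdist x y <= t) -> False.
Proof.
move=> [p [Pp pt]] PDE Dt Et.
have Dp i j : i != j -> D (p i) -> D (p j) -> False.
  by move=> ij Di Dj; have := pt i j ij; rewrite ltNge Dt.
have Ep i j : i != j -> E (p i) -> E (p j) -> False.
  by move=> ij Ei Ej; have := pt i j ij; rewrite ltNge Et.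
have [i0 i1 i2] : [/\ (0 : 'I_3) != 1, (0 : 'I_3) != (inord 2) & (1 : 'I_3) != inord 2].
  by split; rewrite -val_eqE/= ?inordK.
have [D0|E0] := PDE _ (Pp 0); have [D1|E1] := PDE _ (Pp 1);
  have [D2|E2] := PDE _ (Pp (inord 2));
  by [exact: (Dp _ _ i0)|exact: (Dp _ _ i1)|exact: (Dp _ _ i2)
     |exact: (Ep _ _ i0)|exact: (Ep _ _ i1)|exact: (Ep _ _ i2)].
Qed.

Lemma avoid_boundary C P u : open C -> connected P ->
  P `&` (closure C `&` ~` C) = set0 -> P u ->
  (C u -> P `<=` C) /\ (~ closure C u -> P `<=` ~` closure C).
Proof.
move=> oC cP PC Pu.
have sep : separated C (~` closure C).
  split; first exact: setICr.
  apply/seteqP; split=> // x [Cx].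
  have : closure (~` closure C) `<=` ~` C.
    rewrite [X in _ `<=` X](closure_id (~` C)).1; last exact: open_closedC.
    by apply: closureS => y; apply: contra_not; exact: subset_closure.
  by move=> /[apply].
have PU : P `<=` C `|` ~` closure C.
  move=> x Px; have [Cx|nCx] := pselect (C x); [by left|right => cCx].
  by have : set0 x by rewrite -PC.
have [PC'|PC'] := connected_subset sep PU cP; split => //.
- by move=> nCu; exfalso; apply: nCu; exact/subset_closure/PC'.
- by move=> Cu; exfalso; apply: (PC' _ Pu); exact: subset_closure.
Qed.

Hypothesis balls_connected : condition_B A.

(** If the boundary of [C] lay in a small ball, then the ball would split its
complement into two parts one of which is small; but [P] and [Q] are large and lie
on different sides of the boundary. *)
Lemma boundary_not_small (delta1 K0 : R) C P Q u w z s t :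
  (forall (r : R) (x : A), 0 < r -> r < delta1 ->
     (components (~` cball x r) #<= `I_2)%card /\
     ((components (~` cball x r) #= `I_2)%card ->
       exists2 C, components (~` cball x r) C & (diam C <= (K0 * r)%:E)%E)) ->
  0 < s < delta1 -> 2 * s <= t -> K0 * s <= t -> open C ->
  closure C `&` ~` C `<=` cball z s ->
  connected P -> P `&` (closure C `&` ~` C) = set0 -> P u -> ~ closure C u ->
  three_far P t ->
  connected Q -> Q `&` (closure C `&` ~` C) = set0 -> Q w -> C w ->
  three_far Q t -> False.
Proof.
move=> hG /andP[s0 sd] st Kst oC Cz cP PC Pu nCu P3 cQ QC Qw Cw Q3.
have [_ /(_ nCu) PnC] := avoid_boundary oC cP PC Pu.
have [/(_ Cw) QCw _] := avoid_boundary oC cQ QC Qw.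
set B := cball z s in Cz.
have Bt x y : B x -> B y -> mdist x y <= t.
  rewrite /B/cball/= => Bx By; have := metric_triangle x z y.
  by rewrite (metric_sym x z) => ?; lra.
have out T : three_far T t -> exists2 p, T p & ~ B p.
  move=> T3; apply: contrapT => nex; apply: (three_far_cover T3 _ Bt Bt).
  by move=> p Tp; left; apply: contrapT => nBp; apply: nex; exists p.
have [p Pp nBp] := out _ P3; have [q Qq nBq] := out _ Q3.
have [C2 C2E] := hG s z s0 sd; rewrite -/B in C2 C2E.
pose E x := connected_component (~` B) x.
have Esub x : ~ B x -> (C x -> E x `<=` C) /\
    (~ closure C x -> E x `<=` ~` closure C).
  move=> nBx; apply: avoid_boundary => //.
  - exact: component_connected.
  - apply/seteqP; split=> // y [/connected_component_sub nBy /Cz].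
    by [].
  - exact: connected_component_refl.
have EE x : ~ B x -> components (~` B) (E x) by move=> nBx; exists x.
have Epq x y : ~ B x -> ~ B y -> ~ closure C x -> C y -> E x != E y.
  move=> nBx nBy nCx Cy; apply/eqP => Exy.
  have [_ /(_ nCx)] := Esub _ nBx; rewrite Exy => /(_ y).
  move=> /(_ (connected_component_refl _)) nCy; apply: nCy => //.
  exact: subset_closure.
have nCp := PnC _ Pp; have Cq := QCw _ Qq.
have Edich := card_le2_mem C2 (EE _ nBp) (EE _ nBq) (Epq _ _ nBp nBq nCp Cq).
have PE : P `<=` B `|` E p.
  move=> x Px; have [Bx|nBx] := pselect (B x); [by left|right].
  have [<-|Exq] := Edich _ (EE _ nBx); first exact: connected_component_refl.
  by have /eqP := Epq _ _ nBx nBq (PnC _ Px) Cq.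
have QE : Q `<=` B `|` E q.
  move=> x Qx; have [Bx|nBx] := pselect (B x); [by left|right].
  have [Exp|<-] := Edich _ (EE _ nBx); last exact: connected_component_refl.
  by have /eqP := Epq _ _ nBp nBx nCp (QCw _ Qx); rewrite Exp.
have [|F FC /diam_ub Fs] := C2E.
  exact: card_eq2 C2 (EE _ nBp) (EE _ nBq) (Epq _ _ nBp nBq nCp Cq).
have Ft x y : F x -> F y -> mdist x y <= t.
  by move=> Fx Fy; rewrite (le_trans (Fs _ _ Fx Fy)).
have [Fp|Fq] := Edich _ FC.
- by apply: (three_far_cover P3 PE Bt); rewrite -Fp.
- by apply: (three_far_cover Q3 QE Bt); rewrite -Fq.
Qed.

(** Two disjoint open sets leave a connected separating set between them.  The
closure of the component of [u] in [N1] is connected, and so is the boundary of the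
component of [w] in the complement of that closure. *)
Lemma separating_boundary N1 N2 u w : condition_T A -> open N1 -> open N2 ->
  N1 `&` N2 = set0 -> N1 u -> N2 w ->
  exists C, [/\ open C, C w, ~ closure C u, connected (closure C `&` ~` C) &
    closure C `&` ~` C `<=` ~` (N1 `|` N2)].
Proof.
move=> hT oN1 oN2 N12 N1u N2w.
set Q := connected_component N1 u.
have oQ : open Q by exact: open_connected_component.
have Qu : Q u by exact: connected_component_refl.
have cQN2 : closure Q `&` N2 = set0.
  apply/seteqP; split=> // x [cQx N2x].
  have [y [/connected_component_sub N1y N2y]] := cQx N2 (open_nbhs_nbhs (conj oN2 N2x)).
  by have : set0 y by rewrite -N12.
have nQw : (~` closure Q) w by move=> cQw; have : set0 w by rewrite -cQN2.
set C := connected_component (~` closure Q) w.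
have oC : open C by exact/open_connected_component/closed_openC/closed_closure.
have Cw : C w by exact: connected_component_refl.
have bC : closure C `&` ~` C `<=` closure Q `&` ~` Q.
  move=> x [cCx nCx]; split.
    by have [//|] := closure_component_sub balls_connected (@closed_closure _ Q) cCx.
  move=> Qx; have [y [/connected_component_sub nQy Qy]] :=
    cCx Q (open_nbhs_nbhs (conj oQ Qx)).
  by apply: nQy; exact: subset_closure.
exists C; split => //.
- move=> cCu; have [y [/connected_component_sub nQy Qy]] :=
    cCu Q (open_nbhs_nbhs (conj oQ Qu)).
  by apply: nQy; exact: subset_closure.
- apply: connected_component_boundary => //; first exact: closed_closure.
    exact/connected_closure/component_connected.
  by exists u; exact: subset_closure.
- move=> x /bC[cQx nQx] [N1x|N2x]; last by have : set0 x by rewrite -cQN2.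
  have oE := open_connected_component balls_connected x oN1.
  have [|y [Qy Ey]] := cQx (connected_component N1 x).
    by apply: open_nbhs_nbhs; split => //; exact: connected_component_refl.
  by apply: nQx; exact: connected_component_trans Qy (connected_component_sym Ey).
Qed.

End Separation.

(** * Clusters left by the removal of a vertex set *)

Section Clusters.
Context {R : realType} {A : metricType R}.

Lemma connect_exit (V : finType) (e : rel V) (Q : {set V}) u v :
  connect e u v -> u \in Q -> v \notin Q ->
  exists i j, [/\ connect e u i, connect e u j, e i j, i \in Q & j \notin Q].
Proof.
move=> /connectP[p]; elim: p u => [u /= _ ->|a p IH u /= /andP[ua pa] vE uQ vQ].
  by move=> uQ; rewrite uQ.
have [aQ|aQ] := boolP (a \in Q); last first.
  by exists u, a; split=> //; exact: connect1.
have [i [j [ai aj ij iQ jQ]]] := IH a pa vE aQ vQ.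
by exists i, j; split=> //; apply: connect_trans (connect1 ua) _.
Qed.

(** The nonempty clusters are the connected components left when [S] is removed.  Connectedness
is expressed by the edge that leaves each proper part [Q], because this yields points of
the cluster at prescribed distances. *)
Definition cluster n (x : nat -> A) (S : {set 'I_n}) r (U : {set 'I_n}) :=
  [/\ {in U, forall i, i \notin S},
      forall i j, i \in U -> j \notin S -> j \notin U ->
        r < mdist (x i) (x j)
    & forall (Q : {set 'I_n}) u v, u \in U -> v \in U -> u \in Q -> v \notin Q ->
        exists i j, [/\ i \in U, j \in U, i \in Q, j \notin Q &
          mdist (x i) (x j) <= r]].

Lemma clusters_of_not_k_connected n (x : nat -> A) r k : (0 < k < n)%N -> 0 <= r ->
  ~ k_connected (@geometric_graph R A n x r) k ->
  exists S U W : {set 'I_n}, [/\ (#|S| < k)%N, cluster x S r U, cluster x S r W,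
    U != finset.set0 /\ W != finset.set0 & {in U, forall i, i \notin W}].
Proof.
move=> /andP[k0 kn] r0 nk.
have /existsNP[S /not_implyP[Sk /existsNP[u /existsNP[v /not_implyP[uS /not_implyP[vS nuv]]]]]] :
    ~ forall S : {set 'I_n}, (#|S| <= k.-1)%N -> forall u v : 'I_n,
    u \notin S -> v \notin S ->
    connect [rel i j | [&& i \notin S, j \notin S & geometric_graph x r i j]] u v.
  by move=> h; apply: nk; split; rewrite ?card_ord.
set e : rel 'I_n := [rel i j | _] in nuv.
have esym : connect_sym e.
  apply: sym_connect_sym => i j; rewrite /e/= /geometric_graph/= metric_sym [j == i]eq_sym.
  by rewrite andbCA.
have eS y i : y \notin S -> connect e y i -> i \notin S.
  move=> yS /connectP[p pp ->].
  elim/last_ind: p pp => [//|p z _]; rewrite rcons_path last_rcons.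
  by move=> /andP[_ /and3P[]].
have cl y : y \notin S -> cluster x S r [set i | connect e y i].
  move=> yS; split=> [i|i j|Q i j].
  - by rewrite inE; exact: eS.
  - rewrite !inE => yi jS nyj; rewrite ltNge; apply/negP => xij.
    move: nyj; rewrite (connect_trans yi)//.
    have [->|ij] := eqVneq i j; first exact: connect0.
    by apply: connect1; rewrite /e/= /geometric_graph/= (eS _ _ yS yi) jS ij.
  - rewrite !inE => yi yj iQ jQ.
    have ij : connect e i j by rewrite (connect_trans _ yj)// esym.
    have [i' [j' [ii' ij' /and3P[_ _ /andP[_ xij]] i'Q j'Q]]] := connect_exit ij iQ jQ.
    by exists i', j'; rewrite !inE !(connect_trans yi).
exists S, [set i | connect e u i]%SET, [set i | connect e v i]%SET; split.
- by rewrite (leq_ltn_trans Sk)// ltn_predL.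
- exact: cl.
- exact: cl.
- by split; apply/finset.set0Pn; [exists u|exists v]; rewrite inE connect0.
- move=> i; rewrite !inE => ui; apply/negP => vi; apply: nuv.
  by rewrite (connect_trans ui)// esym.
Qed.

Lemma cluster_sphere n (x : nat -> A) (S : {set 'I_n}) r (U : {set 'I_n}) u v t :
  cluster x S r U -> 0 <= r -> u \in U -> v \in U -> 0 <= t <= mdist (x u) (x v) ->
  exists2 i, i \in U & t <= mdist (x u) (x i) <= t + r.
Proof.
move=> [_ _ cU] r0 uU vU /andP[t0 tuv].
have [->|tn0] := eqVneq t 0; first by exists u => //; rewrite mdistxx add0r lexx.
have t_gt0 : 0 < t by rewrite lt0r tn0.
have [|||| i [j [iU jU]]] := cU [set i : 'I_n | mdist (x u) (x i) < t]%SET u v.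
- by [].
- by [].
- by rewrite inE mdistxx.
- by rewrite inE -leNgt.
rewrite !inE -leNgt => uit tuj ij; exists j => //; rewrite tuj/=.
by rewrite (le_trans (metric_triangle _ (x i) _))// lerD// ltW.
Qed.

(** Open balls of radius [r] around vacant points can contain sample points of [S] only;
around well separated vacant points they are disjoint, so their masses add up. *)
Definition vacant n (x : nat -> A) (S : {set 'I_n}) r : set A :=
  [set z | forall i : 'I_n, i \notin S -> r <= mdist (x i) z].

Definition vacant_family m n (x : nat -> A) (S : {set 'I_n}) r L :=
  exists z : 'I_m -> A, [/\ forall i, vacant x S (r / 2) (z i),
    forall i j, i != j -> r <= mdist (z i) (z j) &
    forall i j, mdist (z i) (z j) <= L * r].

Lemma ltn_natrM (i j : nat) (s : R) : (i < j)%N -> 0 <= s ->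
  i%:R * s + s <= j%:R * s.
Proof. by move=> ij s0; rewrite -[X in _ + X]mul1r -mulrDl natr1 ler_wpM2r// ler_nat. Qed.

(** The cluster has points at distances about [i * (2 * T + 4) * r] from [u], for
[i < m]; the gaps leave room for moving each of them by [T * r]. *)
Lemma vacant_along_cluster m n (x : nat -> A) (S : {set 'I_n}) r (U : {set 'I_n})
    u v (T : R) :
  cluster x S r U -> 0 < r -> 0 <= T -> u \in U -> v \in U ->
  m%:R * (2 * T + 4) * r < mdist (x u) (x v) ->
  (forall i, i \in U -> exists2 z, vacant x S (r / 2) z & mdist (x i) z <= T * r) ->
  vacant_family m x S r (2 * (m%:R * (2 * T + 4) + 1 + T)).
Proof.
move=> cU r0 T0 uU vU uv nearZ.
set c := 2 * T + 4 in uv *.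
have c0 : 0 < c by rewrite /c; lra.
have cr0 : 0 < c * r by rewrite mulr_gt0.
have le_m (i : 'I_m) : i%:R * (c * r) <= m%:R * (c * r).
  by rewrite ler_wpM2r ?(ltW cr0)// ler_nat ltnW.
have f_ex (i : 'I_m) : exists p : 'I_n * A,
    [/\ i%:R * (c * r) <= mdist (x u) (x p.1) <= i%:R * (c * r) + r,
        vacant x S (r / 2) p.2 & mdist (x p.1) p.2 <= T * r].
  have [|j jU dj] := @cluster_sphere _ _ _ _ _ _ _ (i%:R * (c * r)) cU (ltW r0) uU vU.
    rewrite mulr_ge0 ?(ltW cr0)//= (le_trans (le_m _))// ltW//.
    by rewrite mulrA.
  by have [z vz jz] := nearZ _ jU; exists (j, z).
have [f fP] := choice f_ex.
have lt_far (i j : 'I_m) : (i < j)%N -> r <= mdist (f i).2 (f j).2.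
  move=> ij; have [/andP[_ i2] _ iz] := fP i; have [/andP[j1 _] _ jz] := fP j.
  have ijc := ltn_natrM ij (ltW cr0).
  have := metric_triangle (x u) (f i).2 (x (f j).1).
  have := metric_triangle (x u) (x (f i).1) (f i).2.
  have := metric_triangle (f i).2 (f j).2 (x (f j).1).
  rewrite (metric_sym (f j).2) => h1 h2 h3.
  have cE : c * r = 2 * (T * r) + 4 * r by rewrite /c; ring.
  by lra.
have near_u i : mdist (x u) (f i).2 <= (m%:R * c + 1 + T) * r.
  have [/andP[_ i2] _ iz] := fP i; have := le_m i.
  have := metric_triangle (x u) (x (f i).1) (f i).2.
  have -> : (m%:R * c + 1 + T) * r = m%:R * (c * r) + r + T * r by ring.
  by lra.
exists (fun i => (f i).2); split=> [i|i j ij|i j].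
- by have [] := fP i.
- have [/lt_far//|/lt_far|/val_inj/eqP] := ltngtP i j; first by rewrite metric_sym.
  by rewrite (negbTE ij).
- rewrite (le_trans (metric_triangle _ (x u) _))// (metric_sym _ (x u)).
  by rewrite -mulrA; have := near_u i; have := near_u j; lra.
Qed.

(** A connected set of large diameter meets the spheres of radius [i * r] around [u]. *)
Lemma vacant_along_continuum m n (x : nat -> A) (S : {set 'I_n}) r (B : set A) u v L :
  connected B -> B `<=` vacant x S (r / 2) -> 0 < r -> B u -> B v ->
  m%:R * r < mdist u v -> 2 * m%:R <= L -> vacant_family m x S r L.
Proof.
move=> cB Bv r0 Bu Bvv uv mL.
have le_m (i : 'I_m) : i%:R * r <= m%:R * r by rewrite ler_wpM2r ?(ltW r0)// ler_nat ltnW.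
have f_ex (i : 'I_m) : exists z, B z /\ mdist u z = i%:R * r.
  have [|z Bz zE] := connected_mdist cB Bu Bvv (t := i%:R * r); last by exists z.
  by rewrite mulr_ge0 ?(ltW r0)//= (le_trans (le_m _))// ltW.
have [f fP] := choice f_ex.
have lt_far (i j : 'I_m) : (i < j)%N -> r <= mdist (f i) (f j).
  move=> ij; have [_ iz] := fP i; have [_ jz] := fP j.
  have ijc := ltn_natrM ij (ltW r0).
  by have := metric_triangle u (f i) (f j); lra.
exists f; split=> [i|i j ij|i j].
- by apply: Bv; have [] := fP i.
- have [/lt_far//|/lt_far|/val_inj/eqP] := ltngtP i j; first by rewrite metric_sym.
  by rewrite (negbTE ij).
- rewrite (le_trans (metric_triangle _ u _))// (metric_sym _ u).
  have [_ ->] := fP i; have [_ ->] := fP j.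
  have : 2 * m%:R * r <= L * r by rewrite ler_wpM2r// ltW.
  by have := le_m i; have := le_m j; lra.
Qed.

Lemma cball_three_far (u v : A) (t : R) : connected [set: A] -> 0 < t -> 4 * t <= mdist u v ->
  three_far (cball u (4 * t)) t.
Proof.
move=> cA t0 uv.
have [z1 _ z1E] : exists2 z, setT z & mdist u z = 2 * t.
  by apply: (connected_mdist cA (y := v)) => //; apply/andP; split; lra.
have [z2 _ z2E] : exists2 z, setT z & mdist u z = 4 * t.
  by apply: (connected_mdist cA (y := v)) => //; apply/andP; split; lra.
have z12 : t < mdist z1 z2 by have := metric_triangle u z1 z2; lra.
exists (fun i : 'I_3 => nth u [:: u; z1; z2] i); split.
  by case=> [[|[|[|//]]]] ? //=; rewrite /cball/= ?mdistxx; lra.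
by case=> [[|[|[|//]]]] ? [[|[|[|//]]]] ? //= _;
  rewrite ?(metric_sym z1 u) ?(metric_sym z2 u) ?(metric_sym z2 z1); lra.
Qed.

(** If all vacant families of this size fail, then both clusters contain the centre
of a large ball that no vacant point enters, and the vacant continuum between the two
centres is confined to a small ball, against [condition_G]. *)
Lemma large_clusters_vacant_family m : condition_B A -> condition_T A ->
  condition_G A -> (0 < m)%N ->
  exists L r1 : R, [/\ 0 < L, 0 < r1 & forall n (x : nat -> A) (S U W : {set 'I_n}) r,
    0 < r -> r < r1 -> cluster x S r U -> cluster x S r W ->
    {in U, forall i, i \notin W} ->
    forall u0 u1 w0 w1, u0 \in U -> u1 \in U -> L * r < mdist (x u0) (x u1) ->
    w0 \in W -> w1 \in W -> L * r < mdist (x w0) (x w1) ->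
    vacant_family m x S r L].
Proof.
move=> hB hT [delta1 [K0 [d1 K01 hG]]] m0.
have mR0 : 0 < m%:R :> R by rewrite ltr0n.
(* times [r], this bounds the diameter of a ball of radius [m * r] and that of a small
   component of its complement *)
pose t := (2 + K0) * m%:R; have t0 : 0 < t by rewrite mulr_gt0//; lra.
pose T := 4 * t; have T0 : 0 < T by rewrite mulr_gt0.
pose L := 2 * (m%:R * (2 * T + 4) + 1 + T).
have mT0 : 0 < m%:R * (2 * T + 4) by rewrite mulr_gt0//; lra.
have mT1 : m%:R <= m%:R * (2 * T + 4) by rewrite ler_peMr ?ler0n//; lra.
exists L, (delta1 / m%:R); split; rewrite ?divr_gt0//; first by rewrite /L; lra.
move=> n x S U W r r0 rd cU cW UW u0 u1 w0 w1 u0U u1U u01 w0W w1W w01.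
apply: contrapT => nvac.
have lonely (V : {set 'I_n}) v0 v1 : cluster x S r V -> v0 \in V -> v1 \in V ->
    L * r < mdist (x v0) (x v1) ->
    exists2 v, v \in V & cball (x v) (T * r) `&` vacant x S (r / 2) = set0.
  move=> cV v0V v1V v01; apply: contrapT => nV; apply: nvac.
  apply: (vacant_along_cluster cV r0 (ltW T0) v0V v1V).
    by apply: le_lt_trans v01; rewrite ler_pM2r//; rewrite /L; lra.
  move=> i iV; apply: contrapT => nz; apply: nV; exists i => //.
  by apply/seteqP; split=> // z [/= iz vz]; apply: nz; exists z.
have [u uU uZ] := lonely _ _ _ cU u0U u1U u01.
have [w wW wZ] := lonely _ _ _ cW w0W w1W w01.
have far v : exists y, T * r <= mdist (x v) y.
  have [h|h] := leP (T * r) (mdist (x v) (x u0)); first by exists (x u0).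
  exists (x u1); have := metric_triangle (x u0) (x v) (x u1).
  rewrite (metric_sym (x u0) (x v)) => h2.
  have : 2 * T * r <= L * r by rewrite ler_pM2r//; rewrite /L; lra.
  by lra.
pose N1 := \bigcup_(i in [set i | i \in U]) ball (x i) (r / 2).
pose N2 := \bigcup_(i in [set i : 'I_n | i \notin S /\ i \notin U]) ball (x i) (r / 2).
have [US UU _] := cU; have [WS _ _] := cW.
have r20 : 0 < r / 2 by rewrite divr_gt0.
have oball (y : A) : open (ball y (r / 2)) by exact: open_mball.
have N1u : N1 (x u) by exists u => //; exact: ballxx.
have N2w : N2 (x w).
  exists w; last exact: ballxx.
  by split; [exact: WS|apply/negP => /UW; rewrite wW].
have N12 : N1 `&` N2 = set0.
  apply/seteqP; split=> // z [[i /= iU iz] [j [/= jS jU] jz]].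
  move: iz jz; rewrite !ballEmdist/= => iz jz.
  have := UU i j iU jS jU; have := metric_triangle (x i) z (x j).
  by rewrite (metric_sym z); lra.
have [||C [oC Cw nCu cC CN]] := separating_boundary hB hT _ _ N12 N1u N2w.
- by apply: bigcup_open => i _.
- by apply: bigcup_open => i _.
set B := closure C `&` ~` C in cC CN.
have BZ : B `<=` vacant x S (r / 2).
  move=> z /CN nz i iS; rewrite leNgt; apply/negP => iz; apply: nz.
  by have [iU|iU] := boolP (i \in U); [left|right]; exists i; rewrite ?ballEmdist.
have [z Bz] : exists z, B `<=` cball z (m%:R * r).
  have [[z Bz]|B0] := pselect (B !=set0); last first.
    by exists (x u) => z Bz; exfalso; apply: B0; exists z.
  exists z => y By; rewrite /cball/= leNgt; apply/negP => zy; apply: nvac.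
  by apply: (vacant_along_continuum cC BZ r0 Bz By zy); rewrite /L; lra.
have cT (y : A) : connected (cball y (T * r)) by apply: hB; rewrite mulr_gt0.
have avoid v : cball (x v) (T * r) `&` vacant x S (r / 2) = set0 ->
    cball (x v) (T * r) `&` B = set0.
  by move=> vZ; apply/seteqP; split=> // y [vy /BZ Zy]; rewrite -vZ.
have self v : cball (x v) (T * r) (x v).
  by rewrite /cball/= mdistxx mulr_ge0// ltW.
have three v : three_far (cball (x v) (T * r)) (t * r).
  have [y vy] := far v; rewrite /T -mulrA.
  by apply: (cball_three_far (v := y)); [have [] := hT|rewrite mulr_gt0|rewrite mulrA].
apply: (boundary_not_small (s := m%:R * r) (t := t * r) hG _ _ _ oC Bz (cT _) (avoid _ uZ)
  (self _) nCu (three _) (cT _) (avoid _ wZ) (self _) Cw (three _)).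
- by rewrite mulr_gt0//= mulrC -ltr_pdivlMr.
- by rewrite mulrA ler_pM2r// /t ler_pM2r//; lra.
- by rewrite mulrA ler_pM2r// /t ler_pM2r//; lra.
Qed.

End Clusters.

(** * Packings, nets and families of local sets *)

Section Packing.
Context {dA : measure_display} {R : realType} {A : measurableMetricType dA R}.
Hypothesis borelA : borel_sigma_algebra A.
Implicit Types (nu : {measure set A -> \bar R}) (s t : seq A) (e : R).

Lemma closed_measurable (D : set A) : closed D -> measurable D.
Proof.
move=> cD; rewrite -(setCK D); apply: measurableC; rewrite borelA.
by apply: sub_sigma_algebra; exact: closed_openC.
Qed.

Lemma measure_subset nu (B C : set A) : measurable B -> measurable C ->
  B `<=` C -> (nu B <= nu C)%E.
Proof. by move=> mB mC; apply: le_measure; exact: mem_set. Qed.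

Definition union_of (s : seq A) (D : A -> set A) : set A :=
  \big[setU/set0]_(q <- s) D q.

Lemma union_ofP s D x : union_of s D x <-> exists2 q, q \in s & D q x.
Proof.
rewrite /union_of -bigcup_seq; split=> [[q /= qs Dq]|[q qs Dq]]; by exists q.
Qed.

Lemma closed_union_of s D : (forall q, closed (D q)) -> closed (union_of s D).
Proof.
move=> cD; rewrite /union_of.
by elim/big_ind : _ => [|B C cB cC|q _]; [exact: closed0|exact: closedU|exact: cD].
Qed.

Lemma measure_union_of nu s D : (forall q, measurable (D q)) -> uniq s ->
  {in s &, forall p q, p != q -> D p `&` D q = set0} ->
  nu (union_of s D) = (\sum_(q <- s) nu (D q))%E.
Proof.
move=> mD; elim: s => [_ _|q s IH /= /andP[qs us] sD].
  by rewrite /union_of !big_nil measure0.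
rewrite /union_of !big_cons -IH//; last first.
  by move=> p p' ps p's; apply: sD; rewrite inE ?ps ?p's orbT.
rewrite measureU//; first by apply: bigsetU_measurable.
apply/seteqP; split=> // x [Dx /union_ofP[p ps Dpx]].
rewrite -(sD q p) ?inE ?eqxx ?ps ?orbT//.
by apply: contraNneq qs => ->.
Qed.

Lemma packing_bound nu s D (B : set A) (c : R) : (forall q, measurable (D q)) ->
  measurable B -> uniq s -> {in s &, forall p q, p != q -> D p `&` D q = set0} ->
  {in s, forall q, D q `<=` B} -> {in s, forall q, (c%:E <= nu (D q))%E} ->
  (((size s)%:R * c)%:E <= nu B)%E.
Proof.
move=> mD mB us sD DB cD.
apply: (@le_trans _ _ (nu (union_of s D))); last first.
  apply: measure_subset => //; first exact: bigsetU_measurable.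
  by move=> x /union_ofP[q qs]; apply: DB.
rewrite measure_union_of// big_seq.
apply: (@le_trans _ _ (\sum_(q <- s | q \in s) c%:E)%E); last exact: lee_sum.
rewrite -big_seq sumEFin big_const_seq count_predT iter_addr_0.
by rewrite mulr_natl.
Qed.

Definition separated_by e s := pairwise (fun x y => e < mdist x y) s.

Lemma separated_by_uniq e s : 0 <= e -> separated_by e s -> uniq s.
Proof.
move=> e0; elim: s => //= x s IH /andP[xs ss]; rewrite IH// andbT.
by apply/negP => /(allP xs); rewrite mdistxx ltNge e0.
Qed.

Lemma separated_byP e s : separated_by e s ->
  {in s &, forall x y, x != y -> e < mdist x y}.
Proof.
elim: s => //= z s IH /andP[/allP zs ss] x y; rewrite !inE.
move=> /predU1P[->|xs] /predU1P[->|ys]; rewrite ?eqxx//.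
- by move=> _; exact: zs.
- by move=> _; rewrite metric_sym; exact: zs.
- exact: IH.
Qed.

Lemma separated_by_cball e s : separated_by e s ->
  {in s &, forall x y, x != y -> cball x (e / 3) `&` cball y (e / 3) = set0}.
Proof.
move=> ss x y xs ys xy; apply/seteqP; split=> // z [/=]; rewrite /cball/= => xz yz.
have := separated_byP ss xs ys xy.
have := metric_triangle x z y; rewrite (metric_sym z y).
by have := mdist_ge0 x z; lra.
Qed.

Definition is_net e s := separated_by e s /\ forall x, exists2 q, q \in s & mdist q x <= e.

Lemma net_of_bounded e (N : nat) : 0 <= e ->
  (forall s, separated_by e s -> (size s <= N)%N) -> exists s, is_net e s.
Proof.
move=> e0 sN; pose Q n := `[< exists s, separated_by e s /\ size s = n >].
have Q0 : exists n, Q n by exists 0%N; apply/asboolP; exists [::].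
have QN n : Q n -> (n <= N)%N by move=> /asboolP[s [ss <-]]; exact: sN.
case: (ex_maxnP Q0 QN) => n /asboolP[s [ss sn]] nmax.
exists s; split=> // x; apply: contrapT => nex.
have : Q n.+1.
  apply/asboolP; exists (x :: s); split; rewrite /= ?sn//.
  move: ss; rewrite /separated_by/= => ->; rewrite andbT; apply/allP => q qs.
  by rewrite ltNge; apply/negP => xq; apply: nex; exists q; rewrite 1?metric_sym.
by move=> /nmax; rewrite ltnn.
Qed.

(** The balls of radius [e / 3] around the points are disjoint, and doubling compares each
of them with a ball that contains them all. *)
Lemma doubling_local_size nu (L : R) : doubling_measure nu -> exists N : nat,
  forall e x s, 0 < e -> separated_by e s ->
    {in s, forall q, mdist x q <= L * e} -> (size s <= N)%N.
Proof.
move=> [nuf [c' nu2']]; pose c : R := `|c'|.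
have nu2 x r : 0 < r -> (nu (cball x (2 * r)) <= c%:E * nu (cball x r))%E.
  move=> r0; apply: (le_trans (nu2' x r r0)).
  by rewrite lee_wpmul2r// lee_fin ler_norm.
have nu2n x r j : 0 < r -> (nu (cball x (2 ^+ j * r)) <= (c ^+ j)%:E * nu (cball x r))%E.
  move=> r0; elim: j => [|j IH]; first by rewrite !expr0 mul1r mul1e.
  rewrite exprS -mulrA (le_trans (nu2 _ _ _)) ?mulr_gt0 ?exprn_gt0//.
  by rewrite exprS EFinM -muleA lee_wpmul2l ?lee_fin ?normr_ge0.
(* the balls of radius [2 ^+ j * (e / 3)] around the points contain [B] *)
have [j jL] : exists j : nat, 3 * (2 * `|L| + 1) <= 2 ^+ j.
  exists (Num.truncn (3 * (2 * `|L| + 1))).+1.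
  apply: le_trans (ltW (truncnS_gt _)) _.
  by rewrite -natrX ler_nat ltnW// ltn_expl.
exists (Num.truncn (c ^+ j)) => e x s e0 ss sx.
pose B := cball x ((`|L| + 1) * e).
have B0 : 0 < (`|L| + 1) * e by rewrite mulr_gt0// ltr_wpDl.
have [Bgt Blt] := andP (nuf x _ B0); rewrite -/B in Bgt Blt.
have Bfin : nu B \is a fin_num by rewrite ge0_fin_numE// ltW.
have Bf0 : 0 < fine (nu B) by rewrite fine_gt0// Bgt.
have e30 : 0 < e / 3 by rewrite divr_gt0.
have e3e : e / 3 <= e by lra.
have c0 : 0 <= c ^+ j by rewrite exprn_ge0 ?normr_ge0.
have sx' q : q \in s -> mdist x q <= `|L| * e.
  by move=> /sx /le_trans; apply; rewrite ler_wpM2r ?ler_norm// ltW.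
have Bq q : q \in s -> ((fine (nu B))%:E <= (c ^+ j)%:E * nu (cball q (e / 3)))%E.
  move=> qs; rewrite fineK// (le_trans _ (nu2n q (e / 3) j e30))//.
  apply: measure_subset; try exact/closed_measurable/closed_cball.
  move=> y; rewrite /B /cball/= => xy.
  have := metric_triangle q x y; rewrite (metric_sym q x).
  have := sx' _ qs => xq qy; rewrite (le_trans qy)//.
  rewrite (le_trans (lerD xq xy))// -mulrDl mulrA mulrAC ler_wpM2r ?(ltW e0)//.
  by rewrite ler_pdivlMr// mulrC; lra.
have [c00|cn0] := eqVneq (c ^+ j) 0.
  case: s ss sx sx' Bq => // q s _ _ _ /(_ q (mem_head _ _)).
  by rewrite c00 mul0e lee_fin leNgt Bf0.
have cgt : 0 < c ^+ j by rewrite lt0r cn0.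
have h := @packing_bound nu s (fun q => cball q (e / 3)) B ((c ^+ j)^-1 * fine (nu B)).
have : (((size s)%:R * ((c ^+ j)^-1 * fine (nu B)))%:E <= (fine (nu B))%:E)%E.
  rewrite (fineK Bfin); apply: h.
  - by move=> q; exact/closed_measurable/closed_cball.
  - exact/closed_measurable/closed_cball.
  - by apply: separated_by_uniq ss; exact: ltW.
  - exact: separated_by_cball.
  - move=> q qs y; rewrite /B /cball/= => qy.
    rewrite (le_trans (metric_triangle _ q _))// mulrDl mul1r lerD ?sx'//.
    exact: le_trans e3e.
  - by move=> q qs; rewrite EFinM lee_pdivrMl// Bq.
rewrite lee_fin mulrCA mulrA ger_pMl// mulrC ler_pdivrMr// mul1r => sc.
by rewrite Num.Theory.truncn_ge_nat.
Qed.

End Packing.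

Section Families.
Context {dA : measure_display} {R : realType} {A : measurableMetricType dA R}.
Hypothesis borelA : borel_sigma_algebra A.

Definition hits n (x : nat -> A) (F : set A) : nat := (\sum_(i < n) (x i \in F))%N.

Lemma hits_le_card n (x : nat -> A) (S : {set 'I_n}) (F : set A) :
  (forall i : 'I_n, F (x i) -> i \in S) -> (hits n x F <= #|S|)%N.
Proof.
move=> FS; rewrite -sum1_card [X in (_ <= X)%N]big_mkcond /hits.
apply: leq_sum => i _; case: (boolP (x i \in F)) => // /set_mem/FS ->.
by [].
Qed.

Lemma leq_hits n m (x : nat -> A) (F : set A) : (n <= m)%N -> (hits n x F <= hits m x F)%N.
Proof.
move=> nm; rewrite /hits -!(big_mkord xpredT (fun i => (x i \in F) : nat)).
by rewrite [X in (_ <= X)%N](@big_cat_nat _ _ _ n)//= leq_addr.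
Qed.

Definition subseqs (s : seq A) : seq (seq A) :=
  [seq mask m s | m : (size s).-tuple bool].

Lemma mem_filter_subseqs (P : pred A) s : [seq q <- s | P q] \in subseqs s.
Proof.
have sz : size [seq P q | q <- s] == size s by rewrite size_map.
by apply/fintype.imageP; exists (Tuple sz) => //=; rewrite filter_mask.
Qed.

Definition local_sets (net centers : seq A) rho (f : seq A -> set A) : seq (set A) :=
  [seq f t | c <- centers, t <- subseqs [seq q <- net | mdist c q <= rho]].

Lemma size_local_sets net centers rho f N :
  (forall c, (size [seq q <- net | (mdist c q <= rho)%R] <= N)%N) ->
  (size (local_sets net centers rho f) <= size centers * 2 ^ N)%N.
Proof.
move=> szN; rewrite /local_sets size_allpairs_dep.
elim: centers => //= c cs IH; rewrite mulSn leq_add//.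
by rewrite size_map -cardE card_tuple card_bool leq_exp2l.
Qed.

Lemma mem_local_sets net centers rho f c (P : pred A) : c \in centers ->
  (forall q, P q -> mdist c q <= rho) ->
  f [seq q <- net | P q] \in local_sets net centers rho f.
Proof.
move=> cc Prho; apply/allpairsPdep; exists c, [seq q <- net | P q]; split => //.
have -> : [seq q <- net | P q] = [seq q <- [seq q <- net | mdist c q <= rho] | P q].
  rewrite -filter_predI; apply: eq_filter => q /=.
  by have [/Prho ->|] := boolP (P q).
exact: mem_filter_subseqs.
Qed.

Lemma net_of_mass (mu : {measure set A -> \bar R}) (a0 d r0 : R) :
  (mu setT <= 1)%E -> 0 < a0 ->
  (forall x rho, 0 < rho -> rho < r0 -> ((a0 * rho `^ d)%:E <= mu (cball x rho))%E) ->
  forall e, 0 < e -> e < r0 ->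
  exists s : seq A, is_net e s /\ (size s)%:R * (a0 * (e / 3) `^ d) <= 1.
Proof.
move=> mu1 a00 mass e e0 er0.
have e30 : 0 < e / 3 by rewrite divr_gt0.
have e3r0 : e / 3 < r0 by lra.
have w0 : 0 < a0 * (e / 3) `^ d by rewrite mulr_gt0// powR_gt0.
have bound (s : seq A) : separated_by e s -> (size s)%:R * (a0 * (e / 3) `^ d) <= 1.
  move=> ss; rewrite -lee_fin (le_trans _ mu1)//.
  apply: (@packing_bound _ _ _ mu s (fun q => cball q (e / 3))) => //.
  - by move=> q; exact/closed_measurable/closed_cball.
  - by apply: separated_by_uniq ss; exact: ltW.
  - exact: separated_by_cball.
  - by move=> q _; exact: mass.
have [s sn] : exists s : seq A, is_net e s.
  apply: (@net_of_bounded _ _ _ e (Num.truncn (a0 * (e / 3) `^ d)^-1)) => [|s /bound].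
    exact: ltW.
  rewrite -ler_pdivlMr// mul1r => sz.
  by rewrite Num.Theory.truncn_ge_nat// invr_ge0 ltW.
by exists s; split=> //; apply: bound; have [] := sn.
Qed.

(** The annulus around the discretised cluster contains no sample points outside [S]:
such a point is too close to the cluster to be unrelated to it, and too far to belong
to it.  The factor [1 - 3 * dl] absorbs the discretisation error. *)
Lemma small_cluster_annulus n (x : nat -> A) (S U : {set 'I_n}) (r L dl : R) net u :
  0 < r -> 0 < dl -> cluster x S r U -> u \in U ->
  (forall i j, i \in U -> j \in U -> mdist (x i) (x j) <= L * r) ->
  is_net (dl * r) net ->
  let P q := `[< exists2 i, i \in U & mdist q (x i) <= dl * r >] in
  let G := union_of [seq q <- net | P q] (fun q => cball q (dl * r)) in
  [/\ G !=set0, forall g h, G g -> G h -> mdist g h <= (L + 4 * dl) * r,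
    forall g q, G g -> P q -> mdist g q <= (L + 4 * dl) * r &
    forall i : 'I_n, (dilate G ((1 - 3 * dl) * r) `\` G) (x i) -> i \in S].
Proof.
move=> r0 dl0 [US UU _] uU Ud [_ net_e] P G.
have dlr0 : 0 < dl * r by rewrite mulr_gt0.
have UG i : i \in U -> G (x i).
  move=> iU; have [q qs qi] := net_e (x i); apply/union_ofP; exists q => //.
  by rewrite mem_filter qs andbT; apply/asboolP; exists i.
have GP g : G g -> exists2 i, i \in U & mdist g (x i) <= 2 * (dl * r).
  move=> /union_ofP[q]; rewrite mem_filter => /andP[/asboolP[i iU qi] _].
  rewrite /cball/= => qg; exists i => //.
  by rewrite (le_trans (metric_triangle _ q _))// (metric_sym g q); lra.
have Gd g h c : G g -> (exists2 i, i \in U & mdist h (x i) <= c * (dl * r)) -> c <= 2 ->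
    mdist g h <= (L + 4 * dl) * r.
  move=> /GP[i iU gi] [j jU hj] c2.
  have : c * (dl * r) <= 2 * (dl * r) by rewrite ler_wpM2r// ltW.
  have := Ud i j iU jU; have := metric_triangle g (x i) h.
  have := metric_triangle (x i) (x j) h; rewrite (metric_sym (x j) h).
  have -> : (L + 4 * dl) * r = L * r + 4 * (dl * r) by ring.
  by lra.
split.
- by exists (x u); exact: UG.
- by move=> g h Gg /GP hU; apply: Gd Gg hU _.
- move=> g q Gg /asboolP qU; apply: (Gd g q 1 Gg) => //; last by rewrite ler1n.
  by rewrite mul1r.
move=> i [/dilateP/(_ _ dlr0)[g /union_ofP[q]]].
rewrite mem_filter => /andP[/asboolP[j jU qj] _]; rewrite /cball/= => qg ig nG.
have [//|iS] := boolP (i \in S); have [/UG//|iU] := boolP (i \in U).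
have := UU j i jU iS iU; rewrite (metric_sym (x j)).
have := metric_triangle (x i) g (x j); have := metric_triangle g q (x j).
rewrite (metric_sym g q).
have cE : (1 - 3 * dl) * r = r - 3 * (dl * r) by ring.
by rewrite cE in ig; lra.
Qed.

(** The balls are centred at net points so that few unions can arise; the radius [r / 4]
keeps them inside the balls of radius [r / 2] around the vacant points. *)
Lemma vacant_family_mass (mu : {measure set A -> \bar R}) m n (x : nat -> A)
    (S : {set 'I_n}) (r L dl w : R) net :
  (0 < m)%N -> 0 < r -> 0 < dl -> dl <= 8^-1 -> vacant_family m x S r L ->
  is_net (dl * r) net -> (forall y, (w%:E <= mu (cball y (r / 4)))%E) ->
  exists c (P : pred A), [/\ c \in net, forall q, P q -> mdist c q <= (L + 2) * r &
    let F := union_of [seq q <- net | P q] (fun q => cball q (r / 4)) in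
    ((m%:R * w)%:E <= mu F)%E /\ forall i : 'I_n, F (x i) -> i \in S].
Proof.
move=> m0 r0 dl0 dl8 [z [zv zsep zL]] [_ net_e] mass.
have dlr0 : 0 < dl * r by rewrite mulr_gt0.
have dlr8 : dl * r <= r / 8 by rewrite mulrC ler_pM2l.
have qz i : exists q, q \in net /\ mdist q (z i) <= dl * r.
  by have [q] := net_e (z i); exists q.
have [q qP] := choice qz.
pose P y := `[< exists i, mdist y (z i) <= dl * r >].
have qsep i j : i != j -> r / 2 < mdist (q i) (q j).
  move=> ij; have := zsep _ _ ij; have [_ qi] := qP i; have [_ qj] := qP j.
  have := metric_triangle (z i) (q i) (z j); have := metric_triangle (q i) (q j) (z j).
  by rewrite (metric_sym (z i) (q i)); lra.
have inj_q : injective q.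
  move=> i j qij; apply/eqP; apply: contraT => /qsep.
  by rewrite qij mdistxx; lra.
exists (q (Ordinal m0)), P; split.
- by have [] := qP (Ordinal m0).
- move=> y /asboolP[i yi]; have [_ q0] := qP (Ordinal m0).
  have := zL (Ordinal m0) i.
  have := metric_triangle (q (Ordinal m0)) (z (Ordinal m0)) y.
  have := metric_triangle (z (Ordinal m0)) (z i) y.
  by rewrite (metric_sym (z i) y) mulrDl; lra.
move=> F; split; last first.
  move=> i /union_ofP[y]; rewrite mem_filter => /andP[/asboolP[j yj] _].
  rewrite /cball/= => yi; apply: contraT => iS.
  have := zv j i iS; have := metric_triangle (x i) y (z j).
  by rewrite (metric_sym (x i) y); lra.
have -> : m = size [seq q i | i <- enum 'I_m] by rewrite size_map size_enum_ord.
apply: (@packing_bound _ _ _ mu _ (fun q => cball q (r / 4))).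
- by move=> y; exact/closed_measurable/closed_cball.
- by apply/closed_measurable => //; apply: closed_union_of => y; exact: closed_cball.
- by rewrite map_inj_uniq// enum_uniq.
- move=> _ _ /mapP[i _ ->] /mapP[j _ ->] qij.
  have ij : i != j by apply: contraNneq qij => ->.
  apply/seteqP; split=> // y [/=]; rewrite /cball/= => qi qj.
  have := qsep _ _ ij; have := metric_triangle (q i) y (q j).
  by rewrite (metric_sym y); lra.
- move=> _ /mapP[i _ ->] y qy; apply/union_ofP; exists (q i) => //.
  have [qn qi] := qP i; rewrite mem_filter qn andbT.
  by apply/asboolP; exists i.
- by move=> y _; exact: mass.
Qed.

Lemma covering_numberP (D : set A) (r c : R) : (covering_number D r <= c%:E)%E ->
  exists s : seq A, (size s)%:R <= c + 1 /\
    forall y, D y -> exists2 p, p \in s & mdist p y <= r.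
Proof.
move=> cD; have : (covering_number D r < (c + 1)%:E)%E.
  by rewrite (le_lt_trans cD)// lte_fin ltrDl.
move=> /ereal_inf_lt[_ [m [_ [p [_ Dp]]] <-]]; rewrite lte_fin => mc.
exists [seq p i | i <- enum 'I_m]; split; first by rewrite size_map size_enum_ord ltW.
move=> y /Dp[i _ iy]; exists (p i) => //.
by apply: map_f; rewrite mem_enum.
Qed.

Lemma near0P (Q : R -> Prop) :
  (\forall r \near 0^'+, Q r) <-> exists2 e, 0 < e & forall r, 0 < r -> r < e -> Q r.
Proof.
split=> [/nbhs_ballP[e/= e0 eQ]|[e e0 eQ]].
  exists e => // r r0 re; apply: eQ => //=.
  by rewrite -ball_normE/= sub0r normrN gtr0_norm.
near=> r; apply: eQ; by [near: r; exact: nbhs_right_gt|near: r; exact: nbhs_right_lt].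
Unshelve. all: by end_near. Qed.

End Families.

(** * Few sets witness every failure of connectivity *)

Section BadSets.
Context {dA : measure_display} {R : realType} {A : measurableMetricType dA R}.

Lemma near0_scale (c : R) (Q : R -> Prop) : 0 < c ->
  (\forall r \near 0^'+, Q r) -> \forall r \near 0^'+, Q (c * r).
Proof.
move=> c0 /near0P[e e0 eQ]; apply/near0P; exists (e / c); first by rewrite divr_gt0.
move=> r r0 re; apply: eQ; first by rewrite mulr_gt0.
by rewrite mulrC -ltr_pdivlMr.
Qed.

Lemma powR_lt1_approx (d eta : R) : 0 < d -> 0 < eta -> eta < 1 ->
  exists dl : R, [/\ 0 < dl, dl <= 8^-1 & eta <= (1 - 3 * dl) `^ d].
Proof.
move=> d0 eta0 eta1.
have h0 : 0 < eta `^ d^-1 by rewrite powR_gt0.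
have h1 : eta `^ d^-1 < 1.
  have := @gt0_ltr_powR _ d^-1; rewrite invr_gt0 => /(_ d0 eta 1).
  by rewrite powR1; apply => //; rewrite nnegrE// ltW.
(* [5 / 8] keeps [dl] below [8^-1] *)
pose h := Num.max (eta `^ d^-1) (5 / 8).
have hb : 5 / 8 <= h by rewrite /h le_max lexx orbT.
have hlt1 : h < 1 by rewrite /h gt_max h1/=; lra.
exists ((1 - h) / 3); split; [lra|lra|].
rewrite mulrCA divff// mulr1 subKr.
have -> : eta = (eta `^ d^-1) `^ d by rewrite -powRrM mulVf ?gt_eqF// powRr1// ltW.
apply: ge0_ler_powR; rewrite ?nnegrE//; first exact: ltW.
- by rewrite ltW.
- by lra.
- by rewrite le_max lexx.
Qed.

(** The data of a union bound at radius [t]: [o] ranges over the kinds of obstruction to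
connectivity, with [C o * t `^ (- expo o)] events of each kind and mass [coef o * t `^ d]
in each event. *)
Definition witnessing_sets (mu : probability A R) (O : Type) (d : R)
    (coef expo C : O -> R) (t : R) := exists Fs : O -> seq (set A),
  [/\ forall o F, F \in Fs o -> measurable F /\ ((coef o * t `^ d)%:E <= mu F)%E,
      forall o, (size (Fs o))%:R <= C o * t `^ (- expo o) &
      forall n (x : nat -> A) k, (0 < k < n)%N ->
        ~ k_connected (@geometric_graph R A n x t) k ->
        exists o F, F \in Fs o /\ (hits n x F < k)%N].

(** The sets of kind [Some j] are the annuli around the possible shapes of a small cluster
that meet the [j]-th part; those of kind [None] are the unions of balls that come with two
large clusters, where the number of balls is at hand to reach the mass [M]. *)
Lemma bad_sets (borelA : borel_sigma_algebra A)
  (mu : probability A R)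
  (mus : {measure set A -> \bar R}) (mus_doubling : doubling_measure mus)
  (hB : condition_B A) (hT : condition_T A) (hG : condition_G A)
  (l : nat) (d : R) (d_gt0 : 0 < d)
  (a b : 'I_l -> R) (a_gt0 : forall j, 0 < a j) (b_ge0 : forall j, 0 <= b j)
  (hpart : forall K : nat, (0 < K)%N ->
    exists2 r0 : R, 0 < r0 &
    exists T : 'I_l -> R -> set A,
    [/\ forall r : R, 0 < r -> r < r0 ->
          partition [set: 'I_l] (fun j => T j r) [set: A],
        forall j : 'I_l, exists C : R, \forall r \near (0 : R)^'+,
          (covering_number (T j r) r <= (C * r `^ (- b j))%:E)%E
      & forall (j : 'I_l) (r : R), 0 < r -> r < r0 ->
          forall G : set A, measurable G -> G `&` T j r !=set0 ->
          (diam G <= (K%:R * r)%:E)%E ->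
          ((a j * r `^ d)%:E <= mu (dilate G r `\` G))%E])
  (eta M : R) : 0 < eta -> eta < 1 ->
  exists C : option 'I_l -> R, \forall r \near 0^'+,
    witnessing_sets mu d (oapp (fun j => eta * a j) M) (oapp b d) C r.
Proof.
move=> eta0 eta1; pose coef := oapp (fun j => eta * a j) M.
have mu1 : (mu setT <= 1)%E by rewrite probability_setT.
have [dl [dl0 dl8 etad]] := powR_lt1_approx d_gt0 eta0 eta1.
pose c : R := 1 - 3 * dl.
have c0 : 0 < c by rewrite /c; lra.
have c12 : 1 / 2 <= c by rewrite /c; lra.
have c1 : c <= 1 by rewrite /c; lra.
have [a0 [a00 a0a]] : exists a0 : R, 0 < a0 /\ forall j, a0 <= a j.
  exists (\big[Num.min/1]_j a j); split; first by apply: lt_bigmin.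
  by move=> j; apply: bigmin_le_cond.
have [r0 r00 mass] : exists2 r0 : R, 0 < r0 & forall x rho, 0 < rho -> rho < r0 ->
    ((a0 * rho `^ d)%:E <= mu (cball x rho))%E.
  have [r0 r00 [T [Tp _ Ta]]] := hpart 1%N isT.
  exists r0 => // x rho rho0 rhor.
  have [Tcov _ _] := Tp rho rho0 rhor.
  have : [set: A] x by [].
  rewrite -Tcov => -[j _ Tx].
  have mx : measurable [set x] by apply: closed_measurable => //; exact/accessible_closed_set1/hausdorff_accessible/metric_hausdorff.
  have xT : [set x] `&` T j rho !=set0 by exists x.
  have xd : (diam [set x] <= (1%:R * rho)%:E)%E.
    by apply/diam_ub => y z -> ->; rewrite mdistxx mul1r ltW.
  apply: le_trans (le_trans (Ta j rho rho0 rhor [set x] mx xT xd) _).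
    by rewrite lee_fin ler_wpM2r ?powR_ge0.
  apply: measure_subset; first by apply: measurableD => //; apply: closed_measurable => //;
    exact: closed_dilate.
    by apply: closed_measurable => //; exact: closed_cball.
  move=> y [/dilateP yx _]; rewrite /cball/=; apply/ler_addgt0Pl => e /yx[_ -> xy].
  by rewrite metric_sym addrC ltW.
(* [m] balls of radius [r / 4] weigh at least [M * r `^ d] together *)
have w0 : 0 < a0 * 4^-1 `^ d by rewrite mulr_gt0// powR_gt0// invr_gt0.
pose m := (Num.truncn (M / (a0 * 4^-1 `^ d))).+1.
have mM : M <= m%:R * (a0 * 4^-1 `^ d).
  by rewrite -ler_pdivrMr// ltW// truncnS_gt.
have [L [r1 [L0 r10 large]]] := large_clusters_vacant_family hB hT hG (isT : (0 < m)%N).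
(* [K * (c * r)] bounds the diameter of a rounded small cluster, as [1 / 2 <= c] *)
pose K := (Num.truncn (2 * (L + 1))).+1.
have KL : 2 * (L + 1) <= K%:R by rewrite ltW// truncnS_gt.
have [rK rK0 [T [Tp Tc Ta]]] := hpart K isT.
have [N locN] := doubling_local_size borelA ((L + 2) / dl) mus_doubling.
have [C CP] := choice Tc.
pose C' o := if o is Some j then (`|C j| + 1) * c `^ (- b j) * (2 ^ N)%:R
  else (a0 * (dl / 3) `^ d)^-1 * (2 ^ N)%:R.
exists C'; near=> r.
have r_gt0 : 0 < r by near: r; exact: nbhs_right_gt.
have rr1 : r < r1 by near: r; exact: nbhs_right_lt.
have rr0 : r < r0 by near: r; exact: nbhs_right_lt.
have rrK : r < rK by near: r; exact: nbhs_right_lt.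
have rle1 : r <= 1 by near: r; exact: nbhs_right_le.
have cov : forall j, (covering_number (T j (c * r)%R) (c * r)%R <=
    (C j * (c * r) `^ (- b j))%R%:E)%E.
  by near: r; apply: filter_forall => j; exact: (near0_scale c0 (CP j)).
have cr0 : 0 < c * r by rewrite mulr_gt0.
have crr : c * r <= r by rewrite ger_pMl.
have crK : c * r < rK by exact: le_lt_trans rrK.
have dlr0 : 0 < dl * r by rewrite mulr_gt0.
have dlrr : dl * r < r0.
  by rewrite (le_lt_trans _ rr0)// ger_pMl//; lra.
have [net [net_ok net_sz]] := net_of_mass borelA mu1 a00 mass dlr0 dlrr.
have [net_sep _] := net_ok.
have net_loc x : (size [seq q <- net | (mdist x q <= (L + 2) * r)%R] <= N)%N.
  apply: (locN (dl * r) x) => //.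
    by rewrite /separated_by pairwise_filter.
  move=> q; rewrite mem_filter => /andP[xq _].
  by rewrite mulrA divfK// gt_eqF.
have cent j : exists s : seq A,
    (size s)%:R <= (`|C j| + 1) * c `^ (- b j) * r `^ (- b j) /\
    forall y, T j (c * r) y -> exists2 p, p \in s & mdist p y <= c * r.
  have [s [ssz sP]] := covering_numberP (cov j); exists s; split=> //.
  rewrite (le_trans ssz)// -mulrA -powRM ?(ltW c0) ?(ltW r_gt0)// [leRHS]mulrDl mul1r lerD//.
    by rewrite ler_wpM2r ?powR_ge0// ler_norm.
  rewrite powRN invf_ge1 ?powR_gt0// -[leRHS](powRr0 (c * r)).
  by rewrite ger_powR// cr0 (le_trans crr).
have [centers centersP] := choice cent.
pose shape (t : seq A) := union_of t (fun q : A => cball q (dl * r)).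
pose annulus t := dilate (shape t) (c * r) `\` shape t.
pose balls t := union_of t (fun q : A => cball q (r / 4)).
pose raw o := if o is Some j then local_sets net (centers j) ((L + 2) * r) annulus
  else local_sets net net ((L + 2) * r) balls.
have cshape t : closed (shape t) by apply: closed_union_of => q; exact: closed_cball.
have mannulus t : measurable (annulus t).
  by apply: measurableD; apply: closed_measurable => //; exact: closed_dilate.
have mballs t : measurable (balls t).
  by apply: closed_measurable => //; apply: closed_union_of => q; exact: closed_cball.
pose Fs o := [seq F <- raw o | ((coef o * r `^ d)%:E <= mu F)%E].
have witness n (x : nat -> A) k (S : {set 'I_n}) o F : (#|S| < k)%N -> F \in raw o ->
    ((coef o * r `^ d)%:E <= mu F)%E -> (forall i : 'I_n, F (x i) -> i \in S) ->
    exists o F, F \in Fs o /\ (hits n x F < k)%N.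
  move=> Sk Fo Fmu FS; exists o, F; rewrite mem_filter Fmu Fo; split=> //.
  exact: leq_ltn_trans (hits_le_card FS) Sk.
have small n (x : nat -> A) k (S U : {set 'I_n}) u : (#|S| < k)%N -> cluster x S r U ->
    u \in U -> (forall i j, i \in U -> j \in U -> mdist (x i) (x j) <= L * r) ->
    exists o F, F \in Fs o /\ (hits n x F < k)%N.
  move=> Sk cU uU Ud.
  have [] := small_cluster_annulus r_gt0 dl0 cU uU Ud net_ok.
  set P := fun q : A => `[< _ >]; set t := [seq q <- net | P q].
  rewrite -/(shape t) => -[g Gg] Gd GP GS.
  have L4 : (L + 4 * dl) * r <= (L + 1) * r by rewrite ler_wpM2r ?(ltW r_gt0)//; lra.
  have [Tcov _ _] := Tp (c * r) cr0 crK.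
  have : [set: A] g by [].
  rewrite -Tcov => -[j _ Tg].
  have [p ps pg] := (centersP j).2 g Tg.
  apply: (witness _ x _ S (Some j) (annulus t) Sk) => //.
    apply: mem_local_sets ps _ => q Pq.
    rewrite (le_trans (metric_triangle _ g _))//.
    have -> : (L + 2) * r = r + (L + 1) * r by ring.
    by rewrite lerD ?(le_trans pg)// (le_trans (GP _ _ Gg Pq)).
  have tT : shape t `&` T j (c * r) !=set0 by exists g.
  have td : (diam (shape t) <= (K%:R * (c * r))%:E)%E.
    apply/diam_ub => y z Gy Gz; rewrite (le_trans (Gd _ _ Gy Gz))//.
    rewrite (le_trans L4)// mulrA ler_wpM2r ?(ltW r_gt0)//.
    rewrite (@le_trans _ _ (K%:R * (1 / 2)))//; first by lra.
    by rewrite ler_wpM2l.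
  have mshape : measurable (shape t) by exact: closed_measurable.
  rewrite (le_trans _ (Ta j (c * r) cr0 crK (shape t) mshape tT td))//.
  rewrite lee_fin /coef/= powRM ?(ltW c0) ?(ltW r_gt0)// mulrA ler_wpM2r ?powR_ge0//.
  by rewrite mulrC ler_wpM2l// ltW.
exists Fs; split.
- move=> o F; rewrite mem_filter => /andP[-> Fo]; split=> //.
  by case: o Fo => [j|] /allpairsPdep[p [t [_ _ ->]]].
- move=> o; apply: (@le_trans _ _ (size (raw o))%:R).
    by rewrite ler_nat size_filter count_size.
  case: o => [j|] /=.
  + have := size_local_sets (centers j) annulus net_loc; rewrite -(ler_nat R) natrM.
    move=> /le_trans; apply; rewrite [leRHS]mulrAC ler_wpM2r//.
    exact: (centersP j).1.
  + have := size_local_sets net balls net_loc; rewrite -(ler_nat R) natrM.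
    move=> /le_trans; apply; rewrite [leRHS]mulrAC ler_wpM2r//.
    have wr0 : 0 < a0 * (dl / 3) `^ d by rewrite mulr_gt0// powR_gt0// divr_gt0.
    rewrite powRN -invfM -[leRHS]mul1r ler_pdivlMr ?mulr_gt0 ?powR_gt0 ?divr_gt0//.
    by rewrite -mulrA -powRM ?divr_ge0 ?(ltW dl0) ?(ltW r_gt0)// (mulrAC dl).
- move=> n x k kn nk; have [k0 _] := andP kn.
  have [S [U [W [Sk cU cW [/finset.set0Pn[u uU] /finset.set0Pn[w wW]] UW]]]] :=
    clusters_of_not_k_connected kn (ltW r_gt0) nk.
  have dich (V : {set 'I_n}) : (forall i j, i \in V -> j \in V -> mdist (x i) (x j) <= L * r)
      \/ exists i j, [/\ i \in V, j \in V & L * r < mdist (x i) (x j)].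
    have [h|h] := pselect (exists i j, [/\ i \in V, j \in V & L * r < mdist (x i) (x j)]).
      by right.
    by left=> i j iV jV; rewrite leNgt; apply/negP => ij; apply: h; exists i, j.
  have [Us|[u0 [u1 [u0U u1U u01]]]] := dich U; first exact: small Sk cU uU Us.
  have [Ws|[w0' [w1 [w0W w1W w01]]]] := dich W; first exact: small Sk cW wW Ws.
  have vac := large n x S U W r r_gt0 rr1 cU cW UW _ _ _ _ u0U u1U u01 w0W w1W w01.
  have r40 : 0 < r / 4 by rewrite divr_gt0.
  have r4r : r / 4 < r0 by lra.
  have [p [P [pn Pp [Fm FS]]]] := vacant_family_mass borelA (isT : (0 < m)%N) r_gt0 dl0 dl8 vac
    net_ok (fun y => mass y _ r40 r4r).
  apply: (witness _ x _ S None _ Sk _ _ FS).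
    exact: (mem_local_sets _ _ pn Pp).
  rewrite (le_trans _ Fm)// lee_fin /coef (mulrC r) powRM ?invr_ge0 ?(ltW r_gt0)//.
  by rewrite !mulrA ler_wpM2r ?powR_ge0// -mulrA.
Unshelve. all: by end_near. Qed.

End BadSets.

(** * Binomial lower tails and the Borel-Cantelli lemma *)

Section Covered.
Context {d : measure_display} {Om : measurableType d} {R : realType}.
Variable P : probability Om R.
Implicit Types (W V : set Om) (c : R).

(** An outer bound, as the events of interest need not be measurable. *)
Definition prob_le W c :=
  exists V, [/\ measurable V, W `<=` V & (P V <= c%:E)%E].

Lemma prob_le_subset W W' c c' : W' `<=` W -> c <= c' ->
  prob_le W c -> prob_le W' c'.
Proof.
move=> WW cc [V [mV WV PV]]; exists V; split => //; first exact: subset_trans WV.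
by rewrite (le_trans PV)// lee_fin.
Qed.

Lemma prob_le_bigcup (I : eqType) (s : seq I) (W : I -> set Om) (c : I -> R) :
  (forall i, i \in s -> prob_le (W i) (c i)) ->
  prob_le (\bigcup_(i in [set` s]) W i) (\sum_(i <- s) c i).
Proof.
elim: s => [_|i s IH h].
  exists set0; split; rewrite ?measure0 ?big_nil//.
  by move=> x [i].
have [V [mV WV PV]] : prob_le (\bigcup_(i in [set` s]) W i) (\sum_(i <- s) c i).
  by apply: IH => j js; apply: h; rewrite inE js orbT.
have [V' [mV' WV' PV']] : prob_le (W i) (c i) by apply: h; rewrite mem_head.
exists (V' `|` V); split; first exact: measurableU.
- move=> x [j /=]; rewrite inE => /predU1P[->|js] Wx; first by left; apply: WV'.
  by right; apply: WV; exists j.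
- rewrite big_cons EFinD (le_trans (measureU2 _ _ _))//; exact: leeD.
Qed.

Lemma sum_telescope (n : nat) :
  \sum_(i < n) (i.+1%:R * i.+2%:R : R)^-1 = 1 - n.+1%:R^-1.
Proof.
elim: n => [|n IH]; first by rewrite big_ord0 invr1 subrr.
rewrite big_ord_recr/= IH.
have h k : (k.+1%:R : R) != 0 by rewrite pnatr_eq0.
rewrite [n.+2%:R in LHS]mulrS; have -> : n.+2%:R = 1 + n.+1%:R :> R by rewrite mulrS.
by field; rewrite -(natrD _ 1) h/= -mulrS h.
Qed.

Lemma borel_cantelli (W : nat -> set Om) (c : R) :
  (\forall m \near \oo, prob_le (W m) (c * (m.+1%:R * m.+2%:R)^-1)) ->
  {ae P, forall w, \forall m \near \oo, ~ W m w}.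
Proof.
move=> [m0 _ Wc]; pose t i : R := (i.+1%:R * i.+2%:R)^-1.
have t0 i : 0 <= t i by rewrite invr_ge0 mulr_ge0.
have h i : exists V, [/\ measurable V, W (i + m0)%N `<=` V &
    (P V <= (`|c| * t i)%:E)%E].
  apply: (prob_le_subset _ _ (Wc (i + m0)%N (leq_addl _ _))) => //.
  apply: (@le_trans _ _ (`|c| * t (i + m0)%N)); first by rewrite ler_wpM2r ?ler_norm.
  rewrite ler_wpM2l// /t lef_pV2 ?posrE ?mulr_gt0 ?ltr0n//.
  by rewrite -!natrM ler_nat leq_mul// !ltnS leq_addr.
have [V VP] := choice h.
have V0 : P (lim_sup_set V) = 0%E.
  apply: lim_sup_set_cvg0 => [i|]; first by have [] := VP i.
  apply: (@le_lt_trans _ _ `|c|%:E); last by rewrite ltry.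
  apply: lime_le; first by apply: is_cvg_nneseries => *; exact: measure_ge0.
  apply: nearW => n; apply: (@le_trans _ _ (\sum_(0 <= i < n) (`|c| * t i)%:E)%E).
    by apply: lee_sum => i _; have [] := VP i.
  rewrite sumEFin lee_fin big_mkord -mulr_sumr sum_telescope.
  by rewrite -[leRHS]mulr1 ler_wpM2l// gerBl invr_ge0.
exists (lim_sup_set V); split => //.
  by apply: bigcap_measurable => // n _; apply: bigcup_measurable => i _; have [] := VP i.
move=> w /= nw n _; apply: contrapT => nV; apply: nw.
exists (n + m0)%N => // m /= nm Wm; apply: nV; exists (m - m0)%N => /=.
  by rewrite leq_subRL ?(leq_trans _ nm) ?leq_addl// addnC.
have [_ WV _] := VP (m - m0)%N; apply: WV.
by rewrite subnK// (leq_trans _ nm) ?leq_addl.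
Qed.

End Covered.

Section LowerTail.
Context {dOm : measure_display} {Om : measurableType dOm} {R : realType}.
Context {dA : measure_display} {A : measurableMetricType dA R}.
Variables (P : probability Om R) (mu : probability A R) (X : nat -> {mfun Om >-> A}).
Hypothesis X_indep : mutually_independent P X.
Hypothesis X_distr : forall (i : nat) (E : set A), measurable E ->
  distribution P (X i) E = mu E.

(** Markov's inequality for [exp (- s * hits)], whose expectation is computed by
summing over the set of indices of the hits. *)
Lemma hits_lower_tail N (F : set A) (p s kap : R) : measurable F ->
  (p%:E <= mu F)%E -> 0 <= s ->
  prob_le P [set w | (hits N (fun i => X i w) F)%:R <= kap]
    (expR (s * kap - N%:R * p * (1 - expR (- s)))).
Proof.
move=> mF pF s0.
have muF : mu F \is a fin_num by exact: fin_num_measure.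
pose q := fine (mu F).
have qE : mu F = q%:E by rewrite fineK.
have q0 : 0 <= q by rewrite fine_ge0.
have q1 : q <= 1 by rewrite -lee_fin -qE probability_le1.
have pq : p <= q by rewrite -lee_fin -qE.
pose sel (B : {set 'I_N}) (i : nat) : set A :=
  if i \in [seq val j | j <- enum B] then F else ~` F.
have selE (B : {set 'I_N}) (i : 'I_N) : sel B i = if i \in B then F else ~` F.
  by rewrite /sel mem_map ?mem_enum//; exact: val_inj.
pose E (B : {set 'I_N}) := \bigcap_(i in [set` iota 0 N]) (X i @^-1` sel B i).
have msel B i : measurable (sel B i).
  by rewrite /sel; case: ifP => _ //; exact: measurableC.
have mE B : measurable (E B).
  apply: bigcap_measurableType => i _.
  by rewrite -[_ @^-1` _]setTI; exact: measurable_funP.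
have PE B : P (E B) = (\prod_(i < N) (if i \in B then q else 1 - q))%:E.
  rewrite /E X_indep ?iota_uniq//.
  transitivity (\prod_(i < N) (if i \in B then q else 1 - q)%:E)%E.
    rewrite -[in LHS](subn0 N) big_mkord; apply: eq_bigr => i _.
    rewrite -[P _]/(distribution P (X i) (sel B i)) X_distr// selE.
    by case: ifP => _; rewrite ?probability_setC// qE.
  by rewrite prodEFin.
pose good := [pred B : {set 'I_N} | #|B|%:R <= kap].
pose e := expR (- s).
pose c (B : {set 'I_N}) := expR (s * kap) * \prod_(i < N) (if i \in B then q * e else 1 - q).
have c0 B : 0 <= c B.
  rewrite mulr_ge0 ?expR_ge0// prodr_ge0// => i _.
  by case: ifP => _; rewrite ?mulr_ge0 ?expR_ge0 ?subr_ge0.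
have PEc B : good B -> (P (E B) <= (c B)%:E)%E.
  move=> /= Bkap; rewrite PE lee_fin /c.
  have -> : \prod_(i < N) (if i \in B then q * e else 1 - q) =
      e ^+ #|B| * \prod_(i < N) (if i \in B then q else 1 - q).
    rewrite -prodr_const [X in _ = X * _]big_mkcond -big_split/=; apply: eq_bigr => i _.
    by case: ifP => _; rewrite ?mul1r// mulrC.
  rewrite mulrA ler_peMl//.
    by apply: prodr_ge0 => i _; case: ifP => _; rewrite ?subr_ge0.
  rewrite /e -expRM_natl -expRD -[leLHS]expR0 ler_expR mulrN subr_ge0 mulrC.
  by rewrite ler_wpM2l.
have cE : \sum_(B : {set 'I_N}) c B <= expR (s * kap - N%:R * p * (1 - e)).
  rewrite /c -mulr_sumr expRD ler_wpM2l ?expR_ge0//.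
  have -> : \sum_(B : {set 'I_N}) \prod_(i < N) (if i \in B then q * e else 1 - q) =
      \prod_(i < N) (q * e + (1 - q)).
    by rewrite bigA_distr; apply: eq_bigl => B.
  rewrite prodr_const card_ord.
  apply: (@le_trans _ _ (expR (- (q * (1 - e))) ^+ N)).
    apply: lerXn2r; rewrite ?nnegrE ?expR_ge0//.
      by rewrite addr_ge0 ?mulr_ge0 ?expR_ge0 ?subr_ge0.
    apply: le_trans (expR_ge1Dx _); lra.
  rewrite -expRM_natl ler_expR mulrN -mulrA lerN2 ler_wpM2l// ler_wpM2r//.
  by rewrite subr_ge0 /e -[leRHS]expR0 ler_expR oppr_le0.
apply: (prob_le_subset _ cE (W := \bigcup_(B in [set` [seq B <- enum {set 'I_N} | good B]]) E B)).
  move=> w /= wk; exists [set i : 'I_N | X i w \in F]%SET.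
    rewrite /= mem_filter mem_enum andbT /= (le_trans _ wk)// ler_nat.
    rewrite /hits -sum1_card big_mkcond/=; apply: leq_sum => i _.
    by rewrite inE; case: (X i w \in F).
  move=> i /=; rewrite mem_iota add0n => /andP[_ iN].
  rewrite -[i]/(val (Ordinal iN)) selE inE.
  by case: ifPn => [/set_mem//|/negP wF Fw]; apply: wF; exact: mem_set.
have h : prob_le P (\bigcup_(B in [set` [seq B <- enum {set 'I_N} | good B]]) E B)
    (\sum_(B <- [seq B <- enum {set 'I_N} | good B]) c B).
  apply: prob_le_bigcup => B; rewrite mem_filter => /andP[gB _].
  by exists (E B); split => //; exact: PEc.
apply: prob_le_subset h => //.
rewrite big_filter big_enum_cond/= [leRHS](bigID good)/= lerDl.
by apply: sumr_ge0 => B _; exact: c0.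
Qed.

End LowerTail.

(** * Almost sure connectivity from a summability condition *)

Section EventuallyConnected.
Context {dOm : measure_display} {Om : measurableType dOm} {R : realType}.
Context {dA : measure_display} {A : measurableMetricType dA R}.
Variables (P : probability Om R) (mu : probability A R) (X : nat -> {mfun Om >-> A}).
Hypothesis X_indep : mutually_independent P X.
Hypothesis X_distr : forall (i : nat) (E : set A), measurable E ->
  distribution P (X i) E = mu E.

(** The sample size [N m] and the threshold [kap m] serve all [n >= N m] with
[k n <= kap m] at once, because hits only increase with the sample. *)
Lemma ae_eventually_k_connected (O : finType) (d : R) (coef expo C s : O -> R)
  (r kap : nat -> R) (N k : nat -> nat) (c : R) :
  (\forall t \near 0^'+, witnessing_sets mu d coef expo C t) ->
  (forall o, 0 <= s o) ->
  (forall e, 0 < e -> \forall m \near \oo, 0 < r m < e) ->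
  (\forall m \near \oo, forall o, r m `^ (- expo o) *
     expR (s o * kap m - (N m)%:R * (coef o * r m `^ d) * (1 - expR (- s o))) <=
     c * (m.+1%:R * m.+2%:R)^-1) ->
  {ae P, forall w, \forall m \near \oo, forall n, (N m <= n)%N ->
    (k n)%:R <= kap m -> (0 < k n < n)%N ->
    k_connected (@geometric_graph R A n (fun i => X i w) (r m)) (k n)}.
Proof.
move=> /near0P[e e0 bad] s0 r0 sumb.
pose W m := [set w | ~ forall n, (N m <= n)%N ->
    (k n)%:R <= kap m -> (0 < k n < n)%N ->
    k_connected (@geometric_graph R A n (fun i => X i w) (r m)) (k n)].
suff : {ae P, forall w, \forall m \near \oo, ~ W m w}.
  by apply: filterS => w; apply: filterS => m /contrapT.
apply: (@borel_cantelli _ _ _ P W ((\sum_o `|C o|) * c)).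
near=> m.
have /andP[rm0 rme] : 0 < r m < e by near: m; exact: r0.
have [Fs [Fmu Fsz Fbad]] := bad (r m) rm0 rme.
have sum_m : forall o, r m `^ (- expo o) *
     expR (s o * kap m - (N m)%:R * (coef o * r m `^ d) * (1 - expR (- s o))) <=
     c * (m.+1%:R * m.+2%:R)^-1 by near: m.
pose T o := expR (s o * kap m - (N m)%:R * (coef o * r m `^ d) * (1 - expR (- s o))).
have T0 o : 0 <= T o by exact: expR_ge0.
have Tle o : r m `^ (- expo o) * T o <= c * (m.+1%:R * m.+2%:R)^-1 by exact: sum_m.
pose H F := [set w | (hits (N m) (fun i => X i w) F)%:R <= kap m].
have PH : prob_le P (\bigcup_(o in [set` enum O]) \bigcup_(F in [set` Fs o]) H F)
    (\sum_(o <- enum O) \sum_(F <- Fs o) T o).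
  apply: prob_le_bigcup => o _; apply: prob_le_bigcup => F FFs.
  have [mF muF] := Fmu o F FFs.
  exact: (hits_lower_tail X_indep X_distr _ _ mF muF (s0 o)).
apply: prob_le_subset PH.
  move=> w /existsNP[n /not_implyP[Nn /not_implyP[kk /not_implyP[kn nk]]]].
  have [j [F [FFs hk]]] := Fbad n _ _ kn nk.
  exists j; first by rewrite /= mem_enum.
  exists F => //; rewrite /H/= (le_trans _ kk)// ler_nat ltnW//.
  by apply: leq_ltn_trans hk; exact: leq_hits.
rewrite big_enum/= -mulrA mulr_suml; apply: ler_sum => o _.
rewrite big_const_seq count_predT iter_addr_0 -(mulr_natl (T o)).
apply: (@le_trans _ _ (`|C o| * (r m `^ (- expo o) * T o))); last first.
  by rewrite ler_wpM2l// Tle.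
rewrite mulrA ler_wpM2r// (le_trans (Fsz o))// ler_wpM2r ?powR_ge0//.
exact: ler_norm.
Unshelve. all: by end_near. Qed.

End EventuallyConnected.

(** * The rate function *)

Section RateFunction.
Context {R : realType}.
Implicit Types (x y s v beta : R).

(** The substitution [y = beta * expR u] turns the equation that defines [Hhat] into a
smooth one in [u]. *)
Lemma mulr_Hfun_expRN beta u : 0 < beta ->
  (beta * expR u) * Hfun (beta / (beta * expR u)) = beta * (expR u - 1 - u).
Proof.
move=> b0; have -> : beta / (beta * expR u) = expR (- u).
  by rewrite invfM mulrA divff ?gt_eqF// mul1r expRN.
rewrite /Hfun gt_eqF ?expR_gt0// expRK expRN.
by field; rewrite gt_eqF ?expR_gt0.
Qed.

Lemma Hhat_spec beta x : 0 <= beta -> 0 <= x ->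
  Hhat beta x * Hfun (beta / Hhat beta x) = x /\ beta <= Hhat beta x.
Proof.
move=> b0 x0.
suff : exists y, [set y : R | y * Hfun (beta / y) = x /\ beta <= y] y.
  exact: (xgetPex 0).
have [bE|bn0] := eqVneq beta 0.
  by exists x; rewrite /= bE mul0r /Hfun eqxx mulr1.
have b_gt0 : 0 < beta by rewrite lt0r bn0.
pose f u := beta * (expR u - 1 - u).
(* large enough, since [(1 + u / 2) ^+ 2 <= expR u] gives [beta * U ^+ 2 / 4 <= f U] *)
pose U := 4 * (x / beta + 1).
have xb : 0 <= x / beta by rewrite divr_ge0.
have U0 : 0 <= U by rewrite /U; lra.
have fU : x <= f U.
  rewrite /f mulrC -ler_pdivrMr//.
  have h : 1 + U / 2 <= expR (U / 2) by exact: expR_ge1Dx.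
  have -> : expR U = expR (U / 2) * expR (U / 2) by rewrite -expRD -splitr.
  have : (1 + U / 2) * (1 + U / 2) <= expR (U / 2) * expR (U / 2).
    by apply: ler_pM => //; rewrite addr_ge0// divr_ge0.
  have UE : x / beta = U / 4 - 1 by rewrite /U; field; rewrite gt_eqF.
  by rewrite UE in xb *; nra.
have [||u uI fu] := @IVT R f 0 U x U0.
- apply: continuous_subspaceT => u; apply: cvgM; first exact: cvg_cst.
  apply: cvgB; last exact: cvg_id.
  by apply: cvgB; [exact: continuous_expR|exact: cvg_cst].
- have -> : f 0 = 0 by rewrite /f expR0 subrr subr0 mulr0.
  by rewrite le_max ge_min x0 fU orbT.
exists (beta * expR u); split; first by rewrite mulr_Hfun_expRN.
rewrite ler_peMr// -[leLHS]expR0 ler_expR.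
by have := uI; rewrite in_itv/= => /andP[].
Qed.

(** For [beta <= y] the supremum over [s >= 0] of [y * (1 - expR (- s)) - s * beta] is
[y * Hfun (beta / y)], attained at [s = ln (y / beta)] when [0 < beta].  It increases
strictly with [y]. *)
Lemma Hhat_lt beta x y : 0 <= beta -> 0 <= x -> Hhat beta x < y ->
  exists2 s, 0 <= s & x < y * (1 - expR (- s)) - s * beta.
Proof.
move=> b0 x0 hy; have [hE bh] := Hhat_spec b0 x0.
set h := Hhat beta x in hy hE bh.
have y0 : 0 < y by rewrite (le_lt_trans b0)// (le_lt_trans bh).
have [bE|bn0] := eqVneq beta 0.
  have hx : h = x by move: hE; rewrite bE mul0r /Hfun eqxx mulr1.
  have yx : 0 < y - x by rewrite subr_gt0 -hx.
  exists (y / (y - x)); first by rewrite divr_ge0 ?ltW.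
  rewrite bE mulr0 subr0 mulrBr mulr1 ltrBrDl addrC -ltrBrDl expRN.
  rewrite ltr_pdivrMr ?expR_gt0//.
  apply: (@lt_le_trans _ _ ((y - x) * (1 + y / (y - x)))).
    by rewrite mulrDr mulr1 mulrCA divff ?gt_eqF// mulr1; lra.
  by rewrite ler_wpM2l ?(ltW yx)// expR_ge1Dx.
have b_gt0 : 0 < beta by rewrite lt0r bn0.
have h0 : 0 < h by exact: lt_le_trans bh.
pose u := ln (h / beta); pose s := ln (y / beta).
have hu : h = beta * expR u by rewrite /u lnK ?posrE ?divr_gt0// mulrC divfK.
have ys : y = beta * expR s by rewrite /s lnK ?posrE ?divr_gt0// mulrC divfK.
have us : u < s by rewrite -(ltr_expR u s) -(ltr_pM2l b_gt0) -hu -ys.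
have u0 : 0 <= u by rewrite /u ln_ge0// ler_pdivlMr// mul1r.
exists s; first by rewrite (le_trans u0)// ltW.
rewrite hu mulr_Hfun_expRN// in hE; rewrite -hE ys.
have -> : beta * expR s * (1 - expR (- s)) - s * beta = beta * (expR s - 1 - s).
  by rewrite expRN; field; rewrite gt_eqF ?expR_gt0.
rewrite ltr_pM2l//.
have su : s - u != 0 by rewrite subr_eq0 gt_eqF.
have : expR s = expR u * expR (s - u) by rewrite -expRD addrC subrK.
have := expR_gt1Dx su; have : 1 <= expR u by rewrite -[leLHS]expR0 ler_expR.
by move=> e1 e2 ->; nra.
Qed.

End RateFunction.

(** * Elementary asymptotics *)

Section Asymptotics.
Context {R : realType}.

Lemma ln_sub1 (x : R) : 0 < x -> ln x <= x - 1.
Proof.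
by move=> x0; have := expR_ge1Dx (ln x); rewrite lnK// => h; lra.
Qed.

Lemma expRN2_ln (n : nat) : (0 < n)%N ->
  expR (- 2 * ln n%:R) <= 6 * (n.+1%:R * n.+2%:R : R)^-1.
Proof.
move=> n0; have n0R : 1 <= n%:R :> R by rewrite ler1n.
have -> : expR (- 2 * ln n%:R) = (n%:R * n%:R : R)^-1.
  have -> : - 2 * ln n%:R = - (ln n%:R + ln n%:R) :> R by ring.
  rewrite expRN expRD lnK// posrE; lra.
rewrite ler_pdivlMr ?mulr_gt0 ?ltr0n// mulrC ler_pdivrMr; last by nra.
by rewrite -!natr1 -addrA; nra.
Qed.

Lemma bernoulli_ge (x : R) (p : nat) : 0 <= x -> x <= 1 -> 1 - p%:R * x <= (1 - x) ^+ p.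
Proof.
move=> x0 x1; elim: p => [|p IH]; first by rewrite expr0 mul0r subr0.
have : (1 - p%:R * x) * (1 - x) <= (1 - x) ^+ p * (1 - x).
  by rewrite ler_wpM2r// subr_ge0.
rewrite exprSr -natr1; have : 0 <= p%:R * (x * x) by rewrite !mulr_ge0.
by lra.
Qed.

(** Keeps all the exponents of a union bound negative while the parameters are
perturbed. *)
Lemma uniform_margin (O : finType) (g K : O -> R) : (forall o, g o < 0) ->
  exists tau theta : R, [/\ 0 < tau, tau < 1, 0 < theta &
    forall o, g o + tau * K o <= - theta].
Proof.
move=> g0; pose m := \big[Num.min/1]_o (- g o).
have m0 : 0 < m by apply: lt_bigmin => // o _; rewrite oppr_gt0.
have m1 : m <= 1 by exact: bigmin_le_id.
pose S := \sum_o `|K o|; have S0 : 0 <= S by apply: sumr_ge0.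
pose tau := m / (2 * (S + 1)).
have tau0 : 0 < tau by rewrite divr_gt0// mulr_gt0// ltr_wpDl.
exists tau, (m / 2); split => //.
- rewrite /tau ltr_pdivrMr; lra.
- by rewrite divr_gt0.
move=> o; have : m <= - g o by exact: bigmin_le_cond.
have KS : K o <= S.
  by rewrite (le_trans (ler_norm _))// /S (bigD1 o)//= lerDl sumr_ge0.
have : tau * K o <= tau * S by rewrite ler_wpM2l// ltW.
have : tau * (S + 1) = m / 2 by rewrite /tau; field; lra.
by lra.
Qed.

Lemma nat_root_between (p n : nat) : (0 < p)%N ->
  exists m : nat, (m ^ p <= n < m.+1 ^ p)%N.
Proof.
move=> p0; have ex0 : exists m, (m ^ p <= n)%N by exists 0%N; rewrite exp0n.
have exn m : (m ^ p <= n)%N -> (m <= n)%N.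
  by apply: leq_trans; case: m => // m; rewrite -{1}(expn1 m.+1) leq_pexp2l.
case: (ex_maxnP ex0 exn) => m mn mmax; exists m; rewrite mn/= ltnNge.
by apply/negP => /mmax; rewrite ltnn.
Qed.

Lemma near_le_ln (c : R) : \forall n \near \oo, c <= ln (n%:R : R).
Proof.
near=> n; rewrite -[leLHS]expRK ler_ln ?posrE ?expR_gt0//.
  by near: n; exact: nbhs_infty_ger.
by rewrite ltr0n; near: n; exact: nbhs_infty_gt.
Unshelve. all: by end_near. Qed.

End Asymptotics.

(** * Upper limits of the connectivity threshold *)

Section Threshold.
Context {R : realType} {A : metricType R}.

Lemma scaled_threshold_le (x : nat -> A) n k (r d c v : R) : 0 < d -> 0 <= r -> 0 <= c ->
  k_connected (@geometric_graph R A n x r) k -> n%:R * r `^ d * c <= v ->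
  (n%:R%:E * connectivity_threshold x n k `^ d * c%:E <= v%:E)%E.
Proof.
move=> d0 r0 c0 kc v_ge.
have tr : (connectivity_threshold x n k <= r%:E)%E.
  by apply: ereal_inf_lbound; exists r.
have t0 : (0 <= connectivity_threshold x n k)%E.
  by apply: le_ereal_inf_tmp => _ [s [s0 _] <-]; rewrite lee_fin.
apply: (@le_trans _ _ (n%:R * r `^ d * c)%:E); last by rewrite lee_fin.
rewrite !EFinM lee_wpmul2r ?lee_fin// lee_wpmul2l ?lee_fin// -poweR_EFin.
by apply: gt0_ler_poweR; rewrite ?in_itv/= ?t0 ?lee_fin ?r0 ?leey// ltW.
Qed.

Lemma limn_esup_le_near (u : nat -> \bar R) (v : \bar R) :
  (\forall n \near \oo, (u n <= v)%E) -> (limn_esup u <= v)%E.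
Proof.
move=> [N _ Nv]; apply: ge_ereal_inf.
exists (ereal_sup (u @` [set n | (N <= n)%N])).
  by exists [set n | (N <= n)%N] => //; exists N.
by apply: ge_ereal_sup => _ [n Nn <-]; exact: Nv.
Qed.

End Threshold.

Section AlmostSureLimsup.
Context {dOm : measure_display} {Om : measurableType dOm} {R : realType}.
Variable P : probability Om R.

Lemma ae_limn_esup_le (l : nat) (u : Om -> nat -> \bar R) (c : 'I_l -> R) : (0 < l)%N ->
  (forall v, (forall j, c j < v) ->
    {ae P, forall w, \forall n \near \oo, (u w n <= v%:E)%E}) ->
  {ae P, forall w, (limn_esup (u w) <= \big[maxe/-oo]_(j < l) (c j)%:E)%E}.
Proof.
move=> l0 h; set M := (\big[maxe/-oo]_(j < l) (c j)%:E)%E.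
have cM j : ((c j)%:E <= M)%E by rewrite /M; exact: le_bigmax.
have M0 : M \is a fin_num.
  rewrite fin_numE; apply/andP; split; apply/eqP => ME.
    by have := cM (Ordinal l0); rewrite ME leeNy_eq.
  have : (M < +oo)%E by apply: bigmax_lt => // j _; rewrite ltry.
  by rewrite ME ltxx.
have hi (i : nat) : {ae P, forall w, \forall n \near \oo,
    (u w n <= (fine M + i.+1%:R^-1)%:E)%E}.
  apply: h => j; rewrite ltr_pwDr ?invr_gt0//.
  by rewrite -lee_fin fineK.
have := ae_foralln hi; apply: filterS => w hw.
apply/lee_addgt0Pr => e e0.
have [i ie] : exists i : nat, i.+1%:R^-1 <= e.
  exists (Num.truncn e^-1); rewrite invf_ple ?posrE ?ltr0n//.
  by rewrite ltW// truncnS_gt.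
rewrite -(fineK M0) -EFinD; apply: limn_esup_le_near.
by apply: filterS (hw i) => n /le_trans; apply; rewrite lee_fin lerD2l.
Qed.

End AlmostSureLimsup.

Section UpperBounds.
Context {dOm : measure_display} {Om : measurableType dOm} {R : realType}.
Context {dA : measure_display} {A : measurableMetricType dA R}.
Variables (P : probability Om R) (mu : probability A R) (X : nat -> {mfun Om >-> A}).
Hypothesis X_indep : mutually_independent P X.
Hypothesis X_distr : forall (i : nat) (E : set A), measurable E ->
  distribution P (X i) E = mu E.
Variables (k : nat -> nat) (l : nat) (d : R) (a b : 'I_l -> R).
Hypothesis k_gt0 : forall n, (0 < n)%N -> (0 < k n)%N.
Hypothesis k_lin : (fun n => (k n)%:R / n%:R : R) @ \oo --> (0 : R).
Hypothesis d_gt0 : 0 < d.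
Hypothesis a_gt0 : forall j, 0 < a j.
Hypothesis b_ge0 : forall j, 0 <= b j.
Hypothesis l_gt0 : (0 < l)%N.
Hypothesis bad : forall eta M : R, 0 < eta -> eta < 1 ->
  exists C : option 'I_l -> R, \forall r \near 0^'+,
    witnessing_sets mu d (oapp (fun j => eta * a j) M) (oapp b d) C r.

Let expo := oapp b d.

Let expo_ge0 o : 0 <= expo o.
Proof. by case: o => [j|] //=; exact: ltW. Qed.

Lemma powR_root_lt (t e : R) : 0 < t -> 0 < e -> t < e `^ d -> t `^ d^-1 < e.
Proof.
move=> t0 e0 te; have -> : e = (e `^ d) `^ d^-1.
  by rewrite -powRrM divff ?gt_eqF// powRr1// ltW.
by apply: gt0_ltr_powR; rewrite ?invr_gt0// nnegrE ?powR_ge0// ltW.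
Qed.

Lemma powR_rootK (t : R) : 0 <= t -> (t `^ d^-1) `^ d = t.
Proof. by move=> t0; rewrite -powRrM mulVf ?gt_eqF// powRr1. Qed.

Lemma powR_root_expR (t e : R) : 0 < t ->
  (t `^ d^-1) `^ (- e) = expR (- (e / d) * ln t).
Proof.
move=> t0; rewrite -powRrM /powR gt_eqF//.
by have -> : d^-1 * - e = - (e / d) by ring.
Qed.

Lemma near_k_lt : \forall n \near \oo, (0 < k n < n)%N.
Proof.
have /cvgrPdist_lt/(_ 1 ltr01) h := k_lin.
near=> n; have n0 : (0 < n)%N by near: n; exact: nbhs_infty_gt.
rewrite k_gt0//=; have : `|0 - (k n)%:R / n%:R : R| < 1 by near: n; exact: h.
rewrite sub0r normrN ger0_norm ?divr_ge0// ltr_pdivrMr ?ltr0n// mul1r.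
by rewrite ltr_nat.
Unshelve. all: by end_near. Qed.

(** When [k n] dominates [ln n], each tail bound [exp (- theta * k n)] beats every
power of [n], hence the number of witnessing sets of each kind. *)
Lemma ae_threshold_superlog (v : R) :
  (fun n => ((k n)%:R / ln n%:R : R)%:E) @ \oo --> +oo%E ->
  (forall j, (a j)^-1 < v) ->
  {ae P, forall w, \forall n \near \oo, (n%:R%:E
     * connectivity_threshold (fun i => X i w) n (k n) `^ d
     * ((k n)%:R^-1)%:E <= v%:E)%E}.
Proof.
move=> k_log av.
have v0 : 0 < v by rewrite (lt_trans _ (av (Ordinal l_gt0)))// invr_gt0.
(* any constant above [1] serves for the kind [None], whose mass is free *)
pose y := oapp (fun j => a j * v) 2.
have [i|tau [th [tau0 tau1 th0 yth]]] := @uniform_margin R _ (fun o => 1 - y o) y.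
  case: i => [j|] /=; last by lra.
  by rewrite subr_lt0 -ltr_pdivrMl// mulr1.
have [||C HC] := @bad (1 - tau) (2 / v); [by lra|by lra|].
set coef := oapp _ _ in HC.
have cv o : 1 + th <= coef o * v.
  have := yth o; case: o => [j|] /=; first by lra.
  by rewrite divfK ?gt_eqF//; lra.
(* between [0] and [th], so that [(1 + th) * (1 - expR (- s))] exceeds [s] *)
pose s := th / 2; pose E := expR (- s).
have s0 : 0 < s by rewrite divr_gt0.
have E0 : 0 < E by exact: expR_gt0.
have Es : E * (1 + s) <= 1.
  rewrite /E expRN mulrC ler_pdivrMr ?expR_gt0// mul1r; exact: expR_ge1Dx.
pose th' := (1 + th) * (1 - E) - s.
have th'0 : 0 < th'.
  have thE : th = 2 * s by rewrite /s; lra.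
  rewrite -(pmulr_rgt0 _ (_ : 0 < 1 + s)); last by lra.
  by rewrite /th' thE; nra.
have E1 : E <= 1 by nra.
pose S := \sum_o expR (- (expo o / d) * ln v).
pose Lam := (\sum_o expo o / d + 2) / th'.
have k_big : \forall n \near \oo, Lam * ln n%:R <= (k n)%:R :> R.
  have /cvgeyPge/(_ Lam) h := k_log.
  near=> n; have ln0 : 0 < ln (n%:R : R).
    by rewrite (lt_le_trans ltr01)//; near: n; exact: near_le_ln.
  by rewrite -ler_pdivlMr// -lee_fin; near: n; exact: h.
pose r n : R := (v * (k n)%:R / n%:R) `^ d^-1.
apply: filterS (@ae_eventually_k_connected _ _ _ _ _ P mu X X_indep X_distr _ d coef expo C
  (fun=> s) r (fun n => (k n)%:R) id k (6 * S) HC (fun=> ltW s0) _ _); last 2 first.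
- move=> e e0; have /cvgrPdist_lt/(_ (e `^ d / v)) h := k_lin.
  have ev0 : 0 < e `^ d / v by rewrite divr_gt0// powR_gt0.
  near=> n; have n0 : (0 < n)%N by near: n; exact: nbhs_infty_gt.
  have t0 : 0 < v * (k n)%:R / n%:R.
    by rewrite divr_gt0 ?mulr_gt0 ?ltr0n// k_gt0.
  rewrite /r powR_gt0//= powR_root_lt// -mulrA mulrC -ltr_pdivlMr//.
  have : `|0 - (k n)%:R / n%:R : R| < e `^ d / v by near: n; exact: h.
  by rewrite sub0r normrN ger0_norm ?divr_ge0.
- near=> n => o; have n0 : (0 < n)%N by near: n; exact: nbhs_infty_gt.
  have n0R : 0 < n%:R :> R by rewrite ltr0n.
  have k1 : 1 <= (k n)%:R :> R by rewrite ler1n k_gt0.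
  have t0 : 0 < v * (k n)%:R / n%:R by rewrite divr_gt0 ?mulr_gt0 ?ltr0n// k_gt0.
  have ln0 : 0 <= ln (n%:R : R) by near: n; exact: near_le_ln.
  rewrite /r powR_root_expR// powR_rootK ?(ltW t0)// -expRD.
  have lnt : ln v - ln n%:R <= ln (v * (k n)%:R / n%:R).
    rewrite -ln_div ?posrE// ler_ln ?posrE// ?divr_gt0//.
    by rewrite ler_wpM2r ?invr_ge0// ler_peMr// ltW.
  have ed0 : 0 <= expo o / d by rewrite divr_ge0// ltW.
  have kth : th' * (k n)%:R <= n%:R * (coef o * (v * (k n)%:R / n%:R)) * (1 - E) - s * (k n)%:R.
    have -> : n%:R * (coef o * (v * (k n)%:R / n%:R)) = coef o * v * (k n)%:R.
      by field; rewrite gt_eqF.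
    have : (1 + th) * ((k n)%:R * (1 - E)) <= coef o * v * ((k n)%:R * (1 - E)).
      by rewrite ler_wpM2r// mulr_ge0// subr_ge0.
    by rewrite /th'; lra.
  have kLam : (expo o / d + 2) * ln n%:R <= th' * (k n)%:R.
    have kb : Lam * ln n%:R <= (k n)%:R by near: n; exact: k_big.
    apply: (@le_trans _ _ (th' * (Lam * ln n%:R))); last by rewrite ler_wpM2l// ltW.
    rewrite mulrA /Lam (mulrC th') divfK ?gt_eqF// ler_wpM2r// lerD2r.
    by rewrite (bigD1 o)//= lerDl sumr_ge0// => i _; rewrite divr_ge0// ltW.
  apply: (@le_trans _ _ (expR (- 2 * ln n%:R) * expR (- (expo o / d) * ln v))).
    rewrite -expRD ler_expR.
    have : (expo o / d) * (ln v - ln n%:R) <= (expo o / d) * ln (v * (k n)%:R / n%:R).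
      by rewrite ler_wpM2l.
    by rewrite -/E; lra.
  rewrite [leRHS]mulrAC; apply: ler_pM; rewrite ?expR_ge0//; first exact: expRN2_ln.
  by rewrite /S (bigD1 o)//= lerDl sumr_ge0// => i _; exact: expR_ge0.
move=> w hw; near=> n.
have n0 : (0 < n)%N by near: n; exact: nbhs_infty_gt.
have n0R : n%:R != 0 :> R by rewrite pnatr_eq0 -lt0n.
have k0R : (k n)%:R != 0 :> R by rewrite pnatr_eq0 -lt0n k_gt0.
apply: (scaled_threshold_le (r := r n)); rewrite ?powR_ge0 ?invr_ge0//.
  have hn : forall m, (n <= m)%N -> (k m)%:R <= (k n)%:R :> R -> (0 < k m < m)%N ->
    k_connected (@geometric_graph R A m (fun i => X i w) (r n)) (k m).
    by near: n; exact: hw.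
  by apply: hn => //; near: n; exact: near_k_lt.
rewrite /r powR_rootK; last by rewrite divr_ge0// mulr_ge0// ltW.
by rewrite le_eqVlt; apply/orP; left; apply/eqP; field; rewrite n0R k0R.
Unshelve. all: by end_near. Qed.

(** Along the blocks [m ^ p <= n < m.+1 ^ p] both [n] and [ln n] vary by a factor tending
to [1], so one radius per block suffices; the block bounds are a power [p * theta] of
[m^-1], summable for large [p]. *)
Lemma ae_threshold_log (beta v : R) : 0 <= beta ->
  (fun n => (k n)%:R / ln n%:R : R) @ \oo --> beta ->
  (forall j, (a j)^-1 * Hhat beta (b j / d) < v) ->
  {ae P, forall w, \forall n \near \oo, (n%:R%:E
     * connectivity_threshold (fun i => X i w) n (k n) `^ d
     * ((ln n%:R)^-1)%:E <= v%:E)%E}.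
Proof.
move=> beta0 k_log av.
have bd0 j : 0 <= b j / d by rewrite divr_ge0// ltW.
have v0 : 0 < v.
  apply: le_lt_trans (av (Ordinal l_gt0)); rewrite mulr_ge0 ?invr_ge0 ?(ltW (a_gt0 _))//.
  by have [_] := Hhat_spec beta0 (bd0 (Ordinal l_gt0)); exact: le_trans.
(* [sp j] exists by the choice of [v]; for the kind [None] any parameter will do, as the mass
   [M] can be adapted to the parameter [1] *)
have sj j : exists s, 0 <= s /\ b j / d < a j * v * (1 - expR (- s)) - s * beta.
  have [s s0 hs] := @Hhat_lt R beta (b j / d) (a j * v) beta0 (bd0 j)
    ltac:(by rewrite -ltr_pdivrMl).
  by exists s.
have [sp spP] := choice sj.
have e1 : 0 < 1 - expR (- 1) :> R by rewrite subr_gt0 -[ltRHS]expR0 ltr_expR; lra.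
pose M := (beta + 2) / (v * (1 - expR (- 1))).
have M0 : 0 < M by rewrite divr_gt0 ?mulr_gt0//; lra.
pose s := oapp sp 1; pose a' := oapp a M.
have s0 o : 0 <= s o by case: o => [j|] //=; have [] := spP j.
have a'0 o : 0 <= a' o by case: o => [j|] /=; exact: ltW.
have E1 o : 0 <= 1 - expR (- s o) <= 1.
  by rewrite subr_ge0 -[X in _ <= X]expR0 ler_expR oppr_le0 s0 gerBl expR_ge0.
pose g o := expo o / d + s o * beta - a' o * v * (1 - expR (- s o)).
pose G o := expo o / d + s o * (beta + 2) + 2 * (a' o * v).
have g0 o : g o < 0.
  rewrite /g; case: o => [j|] /=; first by have [_] := spP j; lra.
  have -> : M * v * (1 - expR (- 1)) = beta + 2 by rewrite /M; field; rewrite !gt_eqF.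
  by rewrite divff ?gt_eqF//; lra.
have [tau [th [tau0 tau1 th0 gth]]] := uniform_margin G g0.
have [||C HC] := @bad (1 - tau) M; [by lra|by lra|].
set coef := oapp _ _ in HC.
have coefE o : (1 - tau) * a' o <= coef o.
  by case: o => [j|] //=; rewrite ger_pMl//; lra.
(* blocks with [p * th >= 2], so that the block bounds are [O(m ^- 2)] *)
pose p := (Num.truncn (2 / th)).+2.
have pth : 2 <= p%:R * th.
  by rewrite -ler_pdivrMr// ltW// (lt_le_trans (truncnS_gt _))// ler_nat /p//.
pose Nm (m : nat) := (m ^ p)%N.
have mNm m : (m <= Nm m)%N by rewrite /Nm; case: m => // m; rewrite -{1}(expn1 m.+1) leq_pexp2l.
have lnN (m : nat) : ln (Nm m)%:R = p%:R * ln m%:R :> R.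
  case: m => [|m]; first by rewrite /Nm exp0n// ln0 ?mulr0.
  by rewrite /Nm natrX lnXn ?ltr0n// mulr_natl.
pose r m : R := (v * ln (Nm m)%:R / (Nm m.+1)%:R) `^ d^-1.
pose kap m := (beta + tau) * ln (Nm m.+1)%:R : R.
have lnm (m : nat) : (0 < m)%N -> ln m.+1%:R <= ln m%:R + 1 :> R.
  move=> m0; rewrite -lerBlDl -ln_div ?posrE ?ltr0n//.
  rewrite (le_trans (ln_sub1 _)) ?divr_gt0 ?ltr0n//.
  rewrite lerBlDr ler_pdivrMr ?ltr0n// mulrDl !mul1r -natrD ler_nat.
  by rewrite -addn1 leq_add2l.
have near_t : \forall m \near \oo, 0 < v * ln (Nm m)%:R / (Nm m.+1)%:R.
  near=> m; have lm : 1 <= ln (m%:R : R) by near: m; exact: near_le_ln.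
  by rewrite divr_gt0 ?ltr0n ?expn_gt0// mulr_gt0// lnN mulr_gt0// (lt_le_trans _ lm).
apply: filterS (@ae_eventually_k_connected _ _ _ _ _ P mu X X_indep X_distr _ d coef expo C
  s r kap Nm k (6 * 1) HC s0 _ _); last 2 first.
- move=> e e0; near=> m.
  have t0 : 0 < v * ln (Nm m)%:R / (Nm m.+1)%:R by near: m; exact: near_t.
  have m0 : (0 < m)%N by near: m; exact: nbhs_infty_gt.
  have m0R : 0 < m%:R :> R by rewrite ltr0n.
  rewrite /r powR_gt0//= powR_root_lt//.
  have mb : v * p%:R / e `^ d < m%:R by near: m; exact: nbhs_infty_gtr.
  rewrite ltr_pdivrMr ?powR_gt0// in mb.
  rewrite ltr_pdivrMr ?ltr0n ?expn_gt0// lnN.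
  have h1 : ln m%:R <= m%:R :> R by have := ln_sub1 m0R; lra.
  have h2 : m%:R * m%:R <= (Nm m.+1)%:R :> R.
    rewrite -natrM ler_nat /Nm mulnn.
    by rewrite (leq_trans (_ : m ^ 2 <= m.+1 ^ 2))%N ?leq_exp2r// leq_pexp2l.
  apply: (@le_lt_trans _ _ (v * p%:R * m%:R)).
    by rewrite -mulrA ler_wpM2l ?(ltW v0)// ler_wpM2l.
  apply: (@lt_le_trans _ _ (m%:R * e `^ d * m%:R)); first by rewrite ltr_pM2r.
  by rewrite mulrAC mulrC ler_wpM2l ?powR_ge0.
- near=> m => o.
  have m0 : (0 < m)%N by near: m; exact: nbhs_infty_gt.
  have t0 : 0 < v * ln (Nm m)%:R / (Nm m.+1)%:R by near: m; exact: near_t.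
  have N0 : 0 < (Nm m.+1)%:R :> R by rewrite ltr0n expn_gt0.
  have Nm0 : 0 < (Nm m)%:R :> R by rewrite ltr0n expn_gt0 m0.
  have lmc c : \forall m \near \oo, c <= ln (m%:R : R) by exact: near_le_ln.
  have lm0 : 0 <= ln (m%:R : R) by near: m; exact: near_le_ln.
  have lm1 : v^-1 <= ln (m%:R : R) by near: m; exact: near_le_ln.
  have lm2 : tau^-1 <= ln (m%:R : R) by near: m; exact: near_le_ln.
  have mp : p%:R / tau <= m%:R by near: m; exact: nbhs_infty_ger.
  set q : R := ln (Nm m)%:R.
  have q0 : 0 <= q by rewrite /q lnN mulr_ge0.
  have vq : 1 <= v * q.
    by rewrite mulrC -ler_pdivrMr// mul1r (le_trans lm1)// /q lnN ler_peMl// ler1n.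
  have qS : ln (Nm m.+1)%:R <= (1 + tau) * q.
    rewrite /q !lnN mulrCA ler_wpM2l// (le_trans (lnm _ m0))// mulrDl mul1r lerD2l.
    by rewrite mulrC -ler_pdivrMr// mul1r.
  have ratio : 1 - tau <= (Nm m)%:R / (Nm m.+1)%:R.
    have m1 : 0 < m.+1%:R :> R by rewrite ltr0n.
    have -> : (Nm m)%:R / (Nm m.+1)%:R = (1 - m.+1%:R^-1) ^+ p :> R.
      rewrite /Nm !natrX -expr_div_n; congr (_ ^+ _).
      by rewrite -[in LHS](addrK 1 m%:R) natr1 mulrBl mul1r divff ?gt_eqF.
    apply: le_trans (bernoulli_ge p _ _); rewrite ?invr_ge0 ?invf_le1 ?ler1n//.
    rewrite lerD2l lerN2 ler_pdivrMr// mulrC -ler_pdivrMr// (le_trans mp)//.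
    by rewrite ler_nat.
  rewrite /r powR_root_expR// powR_rootK ?(ltW t0)// -expRD mulr1 -/q.
  apply: (le_trans _ (expRN2_ln m0)); rewrite ler_expR.
  have ed0 : 0 <= expo o / d by rewrite divr_ge0// ltW.
  have h1 : - (expo o / d) * ln (v * q / (Nm m.+1)%:R) <= expo o / d * ((1 + tau) * q).
    rewrite mulNr -mulrN ler_wpM2l// (le_trans _ qS)//.
    rewrite ln_div ?posrE//; last by rewrite (lt_le_trans _ vq).
    by rewrite opprB gerBl ln_ge0.
  have h2 : s o * kap m <= s o * ((beta + tau) * ((1 + tau) * q)).
    by rewrite ler_wpM2l// ler_wpM2l//; lra.
  have /andP[Eo0 Eo1] := E1 o.
  have h3 : (1 - tau) * a' o * v * q * (1 - tau) * (1 - expR (- s o)) <=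
      (Nm m)%:R * (coef o * (v * q / (Nm m.+1)%:R)) * (1 - expR (- s o)).
    rewrite ler_wpM2r//.
    have -> : (Nm m)%:R * (coef o * (v * q / (Nm m.+1)%:R)) =
        coef o * (v * q) * ((Nm m)%:R / (Nm m.+1)%:R) by ring.
    have c1 : (1 - tau) * a' o * (v * q) <= coef o * (v * q).
      by rewrite ler_wpM2r// (le_trans _ vq).
    rewrite -[(1 - tau) * a' o * v * q]mulrA ler_pM//; last by lra.
    by rewrite !mulr_ge0//; lra.
  have h4 : q * (g o + tau * G o) <= q * - th by rewrite ler_wpM2l.
  have h5 : q * th >= 2 * ln m%:R.
    by rewrite /q lnN mulrAC ler_wpM2r.
  have h6 : s o * (beta + tau) * (1 + tau) <= s o * beta + tau * (s o * (beta + 2)).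
    have : 0 <= s o * tau * (1 - tau) by rewrite !mulr_ge0 ?subr_ge0// ltW.
    by lra.
  have h7 : a' o * v * (1 - expR (- s o)) - tau * (2 * (a' o * v)) <=
      (1 - tau) * a' o * v * (1 - tau) * (1 - expR (- s o)).
    have av0 : 0 <= a' o * v by rewrite mulr_ge0// ltW.
    have : 0 <= a' o * v * tau ^+ 2 * (1 - expR (- s o)).
      by rewrite !mulr_ge0 ?(ltW v0) ?(ltW tau0).
    have : 0 <= a' o * v * tau * (1 - (1 - expR (- s o))).
      by rewrite !mulr_ge0// ?(ltW tau0)// ?(ltW v0)// subr_ge0.
    by lra.
  have h6q : q * (s o * (beta + tau) * (1 + tau)) <= q * (s o * beta + tau * (s o * (beta + 2))).
    by rewrite ler_wpM2l.
  have h7q : q * (a' o * v * (1 - expR (- s o)) - tau * (2 * (a' o * v))) <=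
      q * ((1 - tau) * a' o * v * (1 - tau) * (1 - expR (- s o))).
    by rewrite ler_wpM2l.
  by rewrite /g /G in h4; lra.
move=> w hw; have [m1 _ m1w] := hw.
have k_le : \forall n \near \oo, (k n)%:R / ln n%:R <= beta + tau :> R.
  by apply: (cvgr_le beta) => //; rewrite ltrDl.
near=> n.
have n0 : (0 < n)%N by near: n; exact: nbhs_infty_gt.
have [m /andP[mn nm]] := @nat_root_between p n isT.
have m1m : (m1 <= m)%N.
  rewrite -ltnS -(ltn_exp2r m1 m.+1 (isT : (0 < p)%N)).
  by apply: leq_ltn_trans nm; near: n; exact: nbhs_infty_ge.
have ln1 : 1 <= ln (n%:R : R) by near: n; exact: near_le_ln.
have lnn0 : 0 < ln (n%:R : R) by exact: lt_le_trans ln1.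
have N0 : 0 < (Nm m.+1)%:R :> R by rewrite ltr0n expn_gt0.
have kn : (0 < k n < n)%N by near: n; exact: near_k_lt.
have lmn : ln (Nm m)%:R <= ln n%:R :> R.
  case: m mn {nm m1m N0} => [|m] mn; first by rewrite lnN ln0 ?mulr0 ?(ltW lnn0).
  by rewrite ler_ln ?posrE ?ltr0n ?expn_gt0// ler_nat.
apply: (scaled_threshold_le (r := r m)); rewrite ?powR_ge0 ?invr_ge0 ?(ltW lnn0)//.
  apply: (m1w m m1m n mn _ kn); rewrite /kap.
  have kle : (k n)%:R / ln n%:R <= beta + tau :> R by near: n; exact: k_le.
  rewrite ler_pdivrMr// in kle; rewrite (le_trans kle)// ler_wpM2l//; first by lra.
  by rewrite ler_ln ?posrE ?ltr0n ?expn_gt0// ler_nat ltnW.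
have lm0 : 0 <= ln (Nm m)%:R :> R.
  by rewrite lnN mulr_ge0//; case: (m) => [|m']; [rewrite ln0|rewrite ln_ge0 ?ler1n].
rewrite /r powR_rootK; last by rewrite divr_ge0// mulr_ge0// ltW.
rewrite ler_pdivrMr//.
have -> : n%:R * (v * ln (Nm m)%:R / (Nm m.+1)%:R) =
    v * (n%:R / (Nm m.+1)%:R * ln (Nm m)%:R) by ring.
rewrite ler_wpM2l ?(ltW v0)// -[leRHS]mul1r ler_pM ?divr_ge0//.
by rewrite ler_pdivrMr// mul1r ler_nat ltnW.
Unshelve. all: by end_near. Qed.

End UpperBounds.

Theorem proposition3p6 (R : realType)
  (dA : measure_display) (A : measurableMetricType dA R)
  (borelA : borel_sigma_algebra A)
  (mu : probability A R)
  (mus : {measure set A -> \bar R}) (mus_doubling : doubling_measure mus)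
  (hO : condition_O A) (hB : condition_B A) (hT : condition_T A)
  (hG : condition_G A)
  (dOm : measure_display) (Om : measurableType dOm) (P : probability Om R)
  (X : nat -> {mfun Om >-> A})
  (X_indep : mutually_independent P X)
  (X_distr : forall (i : nat) (E : set A), measurable E ->
    distribution P (X i) E = mu E)
  (beta : \bar R) (beta_ge0 : (0 <= beta)%E)
  (k : nat -> nat) (k_gt0 : forall n, (0 < n)%N -> (0 < k n)%N)
  (k_log : (fun n => ((k n)%:R / ln n%:R : R)%:E) @ \oo --> beta)
  (k_lin : (fun n => (k n)%:R / n%:R : R) @ \oo --> (0 : R))
  (l : nat) (l_gt0 : (0 < l)%N)
  (d : R) (d_gt0 : 0 < d)
  (a b : 'I_l -> R) (a_gt0 : forall j, 0 < a j) (b_ge0 : forall j, 0 <= b j)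
  (hpart : forall K : nat, (0 < K)%N ->
    exists2 r0 : R, 0 < r0 &
    exists T : 'I_l -> R -> set A,
    [/\ forall r : R, 0 < r -> r < r0 ->
          partition [set: 'I_l] (fun j => T j r) [set: A],
        forall j : 'I_l, exists C : R, \forall r \near (0 : R)^'+,
          (covering_number (T j r) r <= (C * r `^ (- b j))%:E)%E
      & forall (j : 'I_l) (r : R), 0 < r -> r < r0 ->
          forall G : set A, measurable G -> G `&` T j r !=set0 ->
          (diam G <= (K%:R * r)%:E)%E ->
          ((a j * r `^ d)%:E <= mu (dilate G r `\` G))%E]) :
  (beta = +oo%E ->
    {ae P, forall w,
      (limn_esup (fun n => n%:R%:E
           * connectivity_threshold (fun i => X i w) n (k n) `^ d
           * ((k n)%:R^-1)%:E)
       <= \big[maxe/-oo]_(j < l) ((a j)^-1)%:E)%E}) /\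
  ((beta < +oo)%E ->
    {ae P, forall w,
      (limn_esup (fun n => n%:R%:E
           * connectivity_threshold (fun i => X i w) n (k n) `^ d
           * ((ln n%:R)^-1)%:E)
       <= \big[maxe/-oo]_(j < l)
            ((a j)^-1 * Hhat (fine beta) (b j / d))%:E)%E}).
Proof.
have bad (eta M : R) : 0 < eta -> eta < 1 -> exists C : option 'I_l -> R,
    \forall r \near 0^'+, witnessing_sets mu d (oapp (fun j => eta * a j) M) (oapp b d) C r.
  exact: (bad_sets borelA mus_doubling hB hT hG d_gt0 a_gt0 b_ge0 hpart).
split=> [betaE|beta_fin]; apply: ae_limn_esup_le => // v vc.
  apply: (ae_threshold_superlog X_indep X_distr k_gt0 k_lin d_gt0 a_gt0 b_ge0 l_gt0 bad) => //.
  by rewrite -betaE.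
have betaE : beta = (fine beta)%:E by rewrite fineK// ge0_fin_numE.
apply: (ae_threshold_log X_indep X_distr k_gt0 k_lin d_gt0 a_gt0 b_ge0 l_gt0 bad _ _ vc).
  exact: fine_ge0.
by move: k_log; rewrite betaE => /fine_cvgP[].
Qed.
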